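(* Let $a,b$ be relatively prime integers with $b=na+r$, $n\geq 1$, $1\leq r\leq a-1$. Let $C$ be a smooth curve of genus $g$ and let $P\in C$ be a point such that $a$ is the first (smallest positive) non-gap of $P$, $b$ is the first non-gap of $P$ that is not a multiple of $a$, and there is no other non-gap of $P$ strictly between $na$ and $(n+1)a$. Let $Q\in C$ with $Q\neq P$ and $aQ\in|aP|$. If $g>(a-1)(b-a+r)/2$, then $b\notin\mathrm{WS}(Q)$.
   Context: Curves are smooth, irreducible, projective, over $\mathbb{C}$. For a point $P$ on a smooth curve $C$, $\mathrm{WS}(P)=\{0\}\cup\{m\in\mathbb{N}: |mP| \text{ is a base point free linear system}\}$ is the Weierstrass semigroup of $P$ (equivalently, the set of pole orders at $P$ of rational functions regular on $C\setminus\{P\}$); its elements are the non-gaps of $P$. $|D|$ denotes the complete linear system of effective divisors linearly equivalent to $D$. *)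

(* Defs.v *)
From HB Require Import structures.
From mathcomp Require Import all_boot all_order all_algebra.
From mathcomp Require Import mpoly freeg complex.
From mathcomp Require Import boolp reals.

Set Implicit Arguments.
Unset Strict Implicit.
Unset Printing Implicit Defensive.

Import Order.TTheory GRing.Theory Num.Theory.

Local Open Scope ring_scope.
Local Open Scope quotient_scope.

(* MathComp equips the quotient by a prime ideal with a commutative ring
   structure only; [{fraction _}] requires an [idomainType], whose unit
   predicate and inverse are obtained here by choice. *)
Section PrimeQuotient.
Variables (A : comNzRingType) (I : prime_idealr A).
Local Notation S := {ideal_quot I}.

Definition pquot_unit : {pred S} := fun x => `[< exists y : S, y * x = 1 >].

Definition pquot_inv (x : S) : S :=
  if pselect (exists y : S, y * x = 1) is left e then projT1 (cid e) else x.

Lemma pquot_mulVr : {in pquot_unit, left_inverse 1 pquot_inv *%R}.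
Proof.
move=> x /asboolP e; rewrite /pquot_inv; case: pselect => // e'.
exact: (projT2 (cid e')).
Qed.

Lemma pquot_unitP (x y : S) : y * x = 1 -> pquot_unit x.
Proof. by move=> e; apply/asboolP; exists y. Qed.

Lemma pquot_inv_out : {in [predC pquot_unit], pquot_inv =1 id}.
Proof.
move=> x /negP ne; rewrite /pquot_inv; case: pselect => // e.
by case: ne; apply/asboolP.
Qed.

End PrimeQuotient.

HB.instance Definition _ (A : comNzRingType) (I : prime_idealr A) :=
  GRing.ComNzRing_hasMulInverse.Build {ideal_quot I}
    (@pquot_mulVr A I) (@pquot_unitP A I) (@pquot_inv_out A I).

HB.instance Definition _ (A : comNzRingType) (I : prime_idealr A) :=
  GRing.ComUnitRing_isIntegral.Build {ideal_quot I}
    (@Quotient.rquot_IdomainAxiom A I).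

Lemma subf_div (L : fieldType) (u v u' v' : L) : v != 0 -> v' != 0 ->
  u / v - u' / v' = (u * v' - u' * v) / (v * v').
Proof. by move=> nv nv'; rewrite -[- (u' / v')]mulNr addf_div // mulNr. Qed.

Section SubField.
Variables (L : fieldType) (P : divringClosed L).

Record subfield_of := SubFieldOf {
  subfield_val : L;
  subfieldP : subfield_val \in P }.

HB.instance Definition _ := [isSub for subfield_val].
HB.instance Definition _ := [Choice of subfield_of by <:].
HB.instance Definition _ :=
  [SubChoice_isSubIntegralDomain of subfield_of by <:].
HB.instance Definition _ :=
  [SubIntegralDomain_isSubField of subfield_of by <:].

End SubField.

Section ProjectiveVariety.
Variables (F : closedFieldType) (n : nat) (I : prime_idealr {mpoly F[n]}).
Local Notation S := {ideal_quot I}.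

(* Class of U in the fraction field of the homogeneous coordinate ring. *)
Definition coord_proj (U : {mpoly F[n]}) : {fraction S} := tofrac (\pi_S U).

Lemma coord_proj_zmod : zmod_morphism coord_proj.
Proof. by move=> U V; rewrite /coord_proj !rmorphB. Qed.

Lemma coord_proj_monoid : monoid_morphism coord_proj.
Proof.
by split=> [|U V]; rewrite /coord_proj; [rewrite !rmorph1|rewrite !rmorphM].
Qed.

HB.instance Definition _ :=
  GRing.isZmodMorphism.Build _ _ coord_proj coord_proj_zmod.
HB.instance Definition _ :=
  GRing.isMonoidMorphism.Build _ _ coord_proj coord_proj_monoid.

Lemma coord_proj_eq0 U : (coord_proj U == 0) = (U \in I).
Proof.
by rewrite /coord_proj tofrac_eq0 -(rmorph0 \pi_S) -Quotient.idealrBE subr0.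
Qed.

(* Rational functions are the quotients of two forms of the same degree. *)
Definition is_ratfun : {pred {fraction S}} := fun z =>
  `[< exists d (U V : {mpoly F[n]}),
        [/\ U \is d.-homog, V \is d.-homog, V \notin I & z = coord_proj U / coord_proj V] >].

Lemma is_ratfun1 : 1 \in is_ratfun.
Proof.
apply/asboolP; exists 0%N, 1, 1; split; rewrite ?dhomog1 ?idealr1 //.
by rewrite rmorph1 divr1.
Qed.

Lemma is_ratfunB (x y : {fraction S}) :
  x \in is_ratfun -> y \in is_ratfun -> x - y \in is_ratfun.
Proof.
move=> /asboolP[d [U [V [hU hV nV ->]]]] /asboolP[d' [U' [V' [hU' hV' nV' ->]]]].
apply/asboolP; exists (d + d')%N, (U * V' - U' * V), (V * V'); split.
- by apply: rpredB; [|rewrite addnC]; apply: dhomogM.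
- exact: dhomogM.
- by rewrite prime_idealrM negb_or nV.
- rewrite rmorphB !rmorphM /=.
  by apply: subf_div; rewrite coord_proj_eq0.
Qed.

Lemma is_ratfun_div (x y : {fraction S}) :
  x \in is_ratfun -> y \in is_ratfun -> x / y \in is_ratfun.
Proof.
move=> /asboolP[d [U [V [hU hV nV ->]]]] /asboolP[d' [U' [V' [hU' hV' nV' ->]]]].
apply/asboolP; have [IU'|nU'] := boolP (U' \in I).
  exists d, 0, V; split=> //; first exact: rpred0.
  move: IU'; rewrite -coord_proj_eq0 => /eqP ->.
  by rewrite rmorph0 !mul0r invr0 mulr0.
exists (d + d')%N, (U * V'), (V * U'); split.
- exact: dhomogM.
- exact: dhomogM.
- by rewrite prime_idealrM negb_or nV.
- by rewrite !rmorphM /= invf_div mulf_div.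
Qed.

Lemma is_ratfun_divring_closed : divring_closed is_ratfun.
Proof. split; [exact: is_ratfun1|exact: is_ratfunB|exact: is_ratfun_div]. Qed.

HB.instance Definition _ := GRing.isDivringClosed.Build {fraction S} is_ratfun
  is_ratfun_divring_closed.

Definition function_field : fieldType := subfield_of is_ratfun.

Local Notation K := function_field.

Lemma constant_subproof (c : F) : coord_proj c%:MP \in is_ratfun.
Proof.
apply/asboolP; exists 0%N, c%:MP, 1; split; rewrite ?dhomog1 ?idealr1 //.
  by rewrite -[c%:MP]mulr1 mul_mpolyC rpredZ ?dhomog1.
by rewrite rmorph1 divr1.
Qed.

Definition constant (c : F) : K := SubFieldOf (constant_subproof c).

Definition is_homogeneous : Prop :=
  forall U, U \in I -> forall d, pihomog mdeg d U \in I.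

Definition alg_independent (k : nat) (x : 'I_k -> K) : Prop :=
  forall G : {mpoly F[k]}, mmap constant x G = 0 -> G = 0.

(* The dimension of a projective variety is the transcendence degree of its
   function field over the base field. *)
Definition has_dimension (d : nat) : Prop :=
  (exists x : 'I_d -> K, alg_independent x) /\
  (forall k (x : 'I_k -> K), alg_independent x -> (k <= d)%N).

(* A point of projective space is represented by its unique vector of
   homogeneous coordinates whose first nonzero coordinate is 1. *)
Definition is_normalized (p : {ffun 'I_n -> F}) : bool :=
  [exists i, (p i == 1) && [forall j : 'I_n, (j < i)%N ==> (p j == 0)]].

Definition is_point (p : {ffun 'I_n -> F}) : bool :=
  is_normalized p && `[< forall U, U \in I -> U.@[p] = 0 >].

Record point := Point {
  point_val :> {ffun 'I_n -> F};
  pointP : is_point point_val }.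

HB.instance Definition _ := [isSub for point_val].
HB.instance Definition _ := [Choice of point by <:].

(* Jacobian criterion, for a curve in a projective space of dimension n - 1:
   some elements of I have a Jacobian matrix of rank n - 2 at p. *)
Definition is_smooth_at (p : point) : Prop :=
  exists k (U : 'I_k -> {mpoly F[n]}), (forall i, U i \in I) /\
    (\rank (\matrix_(i < k, j < n) (U i)^`M(j).@[p])).+2 = n.

Definition in_local_ring (p : point) (z : K) : Prop :=
  exists d (U V : {mpoly F[n]}),
    [/\ U \is d.-homog, V \is d.-homog, V.@[p] != 0
      & val z = coord_proj U / coord_proj V].

Definition in_max_ideal (p : point) (z : K) : Prop :=
  exists d (U V : {mpoly F[n]}),
    [/\ U \is d.-homog, V \is d.-homog, V.@[p] != 0, U.@[p] = 0
      & val z = coord_proj U / coord_proj V].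

Definition is_uniformizer (p : point) (t : K) : Prop :=
  in_max_ideal p t /\
  forall z, in_max_ideal p z -> exists2 u, in_local_ring p u & z = u * t.

Definition has_order (p : point) (z : K) (m : int) : Prop :=
  exists t u : K,
    [/\ is_uniformizer p t, in_local_ring p u, ~ in_max_ideal p u
      & z = u * t ^ m].

Definition divisor := {freeg point / int}.

Definition is_effective (D : divisor) : Prop :=
  forall p, (0 : int) <= coeff p D.

Definition is_principal (D : divisor) : Prop :=
  exists2 z : K, z != 0 & forall p, has_order p z (coeff p D).

Definition in_linear_system (D E : divisor) : Prop :=
  is_effective E /\ is_principal (E - D).

Definition is_base_point_free (D : divisor) : Prop :=
  forall p, exists2 E, in_linear_system D E & coeff p E = 0.

Definition point_mul (m : nat) (p : point) : divisor := << m%:Z *g p >>.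

Definition nongap (p : point) (m : nat) : Prop :=
  m = 0%N \/ is_base_point_free (point_mul m p).

Definition is_derivation (D : K -> K) : Prop :=
  [/\ forall x y, D (x + y) = D x + D y,
      forall x y, D (x * y) = D x * y + x * D y
    & forall c, D (constant c) = 0].

(* The sequence of the (u_i, x_i) stands for the Kaehler differential
   sum_i u_i dx_i.  As Der(K) is the K-dual of the space of differentials of
   K / F, hence separates its elements, two such expressions denote the same
   differential if and only if all derivations take the same value on them. *)
Definition rat_diff := seq (K * K).

Definition diff_eval (w : rat_diff) (D : K -> K) : K :=
  \sum_(ux <- w) ux.1 * D ux.2.

Definition diff_eq (w w' : rat_diff) : Prop :=
  forall D, is_derivation D -> diff_eval w D = diff_eval w' D.

Definition is_regular_at (p : point) (w : rat_diff) : Prop :=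
  exists2 w' : rat_diff, diff_eq w w' &
    forall ux, ux \in w' -> in_local_ring p ux.1 /\ in_local_ring p ux.2.

Definition diff_independent (k : nat) (w : 'I_k -> rat_diff) : Prop :=
  forall c : 'I_k -> F,
    (forall D, is_derivation D ->
       \sum_(i < k) constant (c i) * diff_eval (w i) D = 0) ->
    forall i, c i = 0.

Definition is_regular_family (k : nat) (w : 'I_k -> rat_diff) : Prop :=
  (forall i p, is_regular_at p (w i)) /\ diff_independent w.

(* The genus is the dimension of the space of regular differentials. *)
Definition has_genus (g : nat) : Prop :=
  (exists w : 'I_g -> rat_diff, is_regular_family w) /\
  (forall k (w : 'I_k -> rat_diff), is_regular_family w -> (k <= g)%N).

End ProjectiveVariety.

(* The curve is Proj of the quotient of F[X_0, ..., X_N] by a homogeneous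
   prime ideal; primality encodes irreducibility. *)
Record smooth_projective_curve (F : closedFieldType) := Curve {
  ambient_dim : nat;
  curve_ideal :> prime_idealr {mpoly F[ambient_dim.+1]};
  curve_homogeneous : is_homogeneous curve_ideal;
  curve_dimension : has_dimension curve_ideal 1;
  curve_smooth : forall p : point curve_ideal, is_smooth_at p }.

Definition is_least (A : nat -> Prop) (m : nat) : Prop :=
  A m /\ forall k, A k -> (m <= k)%N.

(* Main.v *)
(* Suppose that b is a non-gap of Q. With div f = aQ - aP and h of polar divisor bQ,
   the function y = (h - h(P)) f^(n+1) is regular outside P, has a pole of order b
   at P and a zero of order a - r at Q. The relation between f and y then has its
   Newton polygon in the triangle with vertices (0, a), (a - r, 0), (b, 0), which
   contains (a - 1)(b - a + r)/2 interior lattice points, and this number bounds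
   the genus.
   The bound is obtained from traces over C(f). For a regular differential phi df,
   Tr(y^j phi) is a polynomial in f, since phi has order at least 1 - e where f has
   ramification index e; here the functions regular outside P form a free module of
   rank a over C[f], with a basis given by the minimal pole orders in the residue
   classes modulo a. The orders at P and Q of the powers y^j, j < a, are distinct
   modulo a, hence the orders of Tr(y^j phi) at P and Q bound its degree and its
   order at 0: the monomials left are the interior points of the triangle. The
   traces Tr(y^j phi) determine phi.
   Completeness of the curve is not needed: a regular function vanishing at P would
   yield a simple pole at P together with f and y, against a > 1. The dimension of
   the curve enters through algebraic dependence only. *)
Require Import Defs.
From HB Require Import structures.
From mathcomp Require Import all_boot all_order all_algebra.
From mathcomp Require Import mpoly freeg complex.
From mathcomp Require Import boolp reals.
From mathcomp Require Import zify ring lra.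

Set Implicit Arguments.
Unset Strict Implicit.
Unset Printing Implicit Defensive.

Import Order.TTheory GRing.Theory Num.Theory.

Local Open Scope ring_scope.

(** * Places of a field *)

Section PolyAt.
Variables (F : comNzRingType) (K : fieldType) (iota : {rmorphism F -> K}).

Definition poly_at (x : K) (p : {poly F}) : K := (map_poly iota p).[x].

Lemma poly_at_zmod x : zmod_morphism (poly_at x).
Proof. by move=> p q; rewrite /poly_at rmorphB hornerD hornerN. Qed.

Lemma poly_at_monoid x : monoid_morphism (poly_at x).
Proof.
by split=> [|p q]; rewrite /poly_at ?rmorph1 ?hornerC // rmorphM hornerM.
Qed.

HB.instance Definition _ x :=
  GRing.isZmodMorphism.Build _ _ (poly_at x) (poly_at_zmod x).
HB.instance Definition _ x :=
  GRing.isMonoidMorphism.Build _ _ (poly_at x) (poly_at_monoid x).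

Lemma poly_atC x c : poly_at x c%:P = iota c.
Proof. by rewrite /poly_at map_polyC hornerC. Qed.

Lemma poly_atX x : poly_at x 'X = x.
Proof. by rewrite /poly_at map_polyX hornerX. Qed.

Lemma poly_atXsubC x c : poly_at x ('X - c%:P) = x - iota c.
Proof. by rewrite rmorphB /= poly_atC poly_atX. Qed.

Lemma poly_atE x p : poly_at x p = \sum_(i < size p) iota p`_i * x ^+ i.
Proof.
rewrite /poly_at (horner_coef_wide _ (size_poly _ _)).
by apply: eq_bigr => i _; rewrite coef_map.
Qed.

End PolyAt.

Section Place.
Variables (F : fieldType) (K : fieldType) (iota : {rmorphism F -> K}).

(** A discrete valuation of [K], trivial on [F] and with residue field [F]. As [int] has no infinite
    element, the axioms concern nonzero arguments only; [vge] restores the convention that 0 has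
    infinite order. *)
Record is_place (v : K -> int) : Prop := IsPlace {
  placeM : forall x y : K, x != 0 -> y != 0 -> v (x * y) = v x + v y;
  placeD : forall x y : K, x != 0 -> y != 0 -> x + y != 0 ->
    (v x <= v (x + y)) || (v y <= v (x + y));
  placeC : forall c, c != 0 -> v (iota c) = 0;
  place_res : forall x : K, x != 0 -> v x = 0 ->
    exists c, x = iota c \/ 0 < v (x - iota c) }.

Definition vge (v : K -> int) (m : int) (x : K) : bool := (x == 0) || (m <= v x).

Variable v : K -> int.
Hypothesis vP : is_place v.

Lemma vge0 m : vge v m 0. Proof. by rewrite /vge eqxx. Qed.

Lemma vge_neq0 m (x : K) : x != 0 -> vge v m x = (m <= v x).
Proof. by rewrite /vge => /negPf->. Qed.

Lemma vge_le m n x : m <= n -> vge v n x -> vge v m x.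
Proof. by move=> mn /orP[/eqP->|h]; rewrite /vge ?eqxx // (le_trans mn h) orbT. Qed.

Lemma vge_all x : (forall m, vge v m x) -> x = 0.
Proof.
by move=> h; apply/eqP; apply: contraT => nx; have := h (v x + 1); rewrite vge_neq0 //; lia.
Qed.

Lemma place1 : v 1 = 0.
Proof. by rewrite -(rmorph1 iota) (placeC vP) ?oner_eq0. Qed.

Lemma placeV (x : K) : x != 0 -> v x^-1 = - v x.
Proof.
move=> nx; have nVx : x^-1 != 0 by rewrite invr_eq0.
by have := placeM vP nx nVx; rewrite divff // place1; lia.
Qed.

Lemma vgeD m (x y : K) : vge v m x -> vge v m y -> vge v m (x + y).
Proof.
have [->|nx] := eqVneq x 0; first by rewrite add0r.
have [->|ny] := eqVneq y 0; first by rewrite addr0.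
have [->|nxy] := eqVneq (x + y) 0; first by rewrite vge0.
by rewrite !vge_neq0 // => mx my; have /orP[] := placeD vP nx ny nxy; lia.
Qed.

Lemma vgeM m n (x y : K) : vge v m x -> vge v n y -> vge v (m + n) (x * y).
Proof.
have [->|nx] := eqVneq x 0; first by rewrite mul0r !vge0.
have [->|ny] := eqVneq y 0; first by rewrite mulr0 !vge0.
by rewrite !vge_neq0 ?mulf_neq0 // (placeM vP) // => mx my; apply: lerD.
Qed.

Lemma vgeC c : vge v 0 (iota c).
Proof.
have [->|nc] := eqVneq c 0; first by rewrite rmorph0 vge0.
by rewrite /vge (placeC vP) // lexx orbT.
Qed.

Lemma vge1 : vge v 0 1. Proof. by rewrite -(rmorph1 iota) vgeC. Qed.

Lemma vgeN m x : vge v m (- x) = vge v m x.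
Proof.
suff h y : vge v m y -> vge v m (- y) by apply/idP/idP => /h //; rewrite opprK.
move=> hy; rewrite -mulN1r -[m]add0r; apply: vgeM => //.
by rewrite -(rmorphN1 iota) vgeC.
Qed.

Lemma vgeB m x y : vge v m x -> vge v m y -> vge v m (x - y).
Proof. by move=> hx hy; apply: vgeD; rewrite ?vgeN. Qed.

Lemma vge_sum (I : Type) (s : seq I) (P : pred I) (x : I -> K) m :
  (forall i, P i -> vge v m (x i)) -> vge v m (\sum_(i <- s | P i) x i).
Proof. by move=> h; apply: (big_ind (vge v m)); [exact: vge0|exact: vgeD|]. Qed.

Lemma vge0X x k : vge v 0 x -> vge v 0 (x ^+ k).
Proof.
move=> hx; elim: k => [|k IH]; first by rewrite expr0 vge1.
by rewrite exprS -[0]addr0 vgeM.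
Qed.

Lemma placeX (x : K) k : x != 0 -> v (x ^+ k) = v x *+ k.
Proof.
move=> nx; elim: k => [|k IH]; first by rewrite expr0 place1.
by rewrite exprS (placeM vP) ?expf_neq0 // IH mulrS.
Qed.

Lemma vge_poly_at x p : vge v 0 x -> vge v 0 (poly_at iota x p).
Proof.
move=> hx; rewrite poly_atE; apply: vge_sum => i _.
by rewrite -[0]addr0 vgeM ?vgeC ?vge0X.
Qed.

Lemma vge_divl m (x y : K) : y != 0 -> vge v (m + v y) (x * y) = vge v m x.
Proof.
move=> ny; have [->|nx] := eqVneq x 0; first by rewrite mul0r !vge0.
by rewrite !vge_neq0 ?mulf_neq0 // (placeM vP) // lerD2r.
Qed.

Lemma vge_unitX (x y : K) k m :
  y != 0 -> v y = 0 -> vge v m (x * y ^+ k) = vge v m x.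
Proof.
move=> ny vy; rewrite -(vge_divl m x (expf_neq0 k ny)) placeX // vy mul0rn.
by rewrite addr0.
Qed.

Lemma placeD_lt (x y : K) : x != 0 -> vge v (v x + 1) y -> x + y != 0 /\ v (x + y) = v x.
Proof.
move=> nx hy; have n : ~~ vge v (v x + 1) (x + y).
  apply/negP => hxy; have := vgeB hxy hy.
  by rewrite addrK vge_neq0 //; lia.
have h : vge v (v x) (x + y).
  by apply: vgeD; [rewrite /vge lexx orbT|apply: vge_le hy; lia].
have nxy : x + y != 0 by apply: contraNneq n => ->; rewrite vge0.
by split=> //; move: n h; rewrite !vge_neq0 //; lia.
Qed.

Lemma vge_res x : vge v 0 x -> exists c, vge v 1 (x - iota c).
Proof.
have [->|nx] := eqVneq x 0; first by exists 0; rewrite rmorph0 subr0 vge0.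
rewrite vge_neq0 // le_eqVlt => /orP[/eqP/esym/(place_res vP nx)[c hc]|vx].
  exists c; case: hc => [->|h]; first by rewrite subrr vge0.
  by rewrite /vge; apply/orP; right; lia.
by exists 0; rewrite rmorph0 subr0 vge_neq0 //; lia.
Qed.

(** The quotient [x / y] has order 0, and its residue is a constant because the residue field is
    [F]. *)
Lemma leading_term (x y : K) : x != 0 -> y != 0 -> v x = v y ->
  exists2 c, c != 0 & vge v (v x + 1) (x - iota c * y).
Proof.
move=> nx ny vxy; have nVy : y^-1 != 0 by rewrite invr_eq0.
have vq : v (x / y) = 0 by rewrite (placeM vP) // placeV // vxy subrr.
have nq : x / y != 0 by rewrite mulf_neq0.
have [|c hc] := @vge_res (x / y); first by rewrite vge_neq0 ?vq.
exists c.
  by apply: contraTneq hc => ->; rewrite rmorph0 subr0 vge_neq0 // vq.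
suff -> : x - iota c * y = (x / y - iota c) * y.
  by rewrite vxy addrC vge_divl.
by rewrite mulrBl divfK.
Qed.

(** Only one term has the least order, so nothing cancels it. *)
Lemma vge_no_cancel (I : finType) (x : I -> K) m :
  (forall i j, i != j -> x i != 0 -> x j != 0 -> v (x i) != v (x j)) ->
  vge v m (\sum_i x i) -> forall i, vge v m (x i).
Proof.
move=> dist hsum i; apply: contraT => ni.
have nxi : x i != 0 by apply: contraNneq ni => ->; rewrite vge0.
have := @arg_minP _ int I i [pred i | x i != 0] (fun i => v (x i)) nxi.
case=> k /= nk hk.
rewrite (bigD1 k) //= in hsum.
have hr : vge v (v (x k) + 1) (\sum_(j | j != k) x j).
  apply: vge_sum => j jk; have [->|nj] := eqVneq (x j) 0; first exact: vge0.
  have := dist _ _ jk nj nk; have := hk j nj; rewrite vge_neq0 //.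
  by rewrite lezD1 lt_neqAle eq_sym => -> ->.
have [ns vs] := placeD_lt nk hr.
move: hsum ni; rewrite !vge_neq0 // vs; have := hk i nxi; lia.
Qed.

(** * Polynomials in a function with a zero or a pole *)

Section TransverseFunction.
Variables (f : K) (s : int).
Hypotheses (nf : f != 0) (vf : v f = s) (ns : s != 0).
Local Notation ev := (poly_at iota f).

Lemma place_term (c : F) (j : nat) : c != 0 ->
  iota c * f ^+ j != 0 /\ v (iota c * f ^+ j) = s * j%:Z.
Proof.
move=> nc; have n1 : iota c != 0 by rewrite fmorph_eq0.
have n2 : f ^+ j != 0 by rewrite expf_neq0.
split; first by rewrite mulf_neq0.
by rewrite (placeM vP) // (placeC vP) // placeX // vf add0r pmulrn mulrzz.
Qed.

(** The monomials of [ev p] have the pairwise distinct orders [s * i], so none cancels. For [s < 0]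
    this bounds the degree of [p], for [s > 0] its order of vanishing at 0. *)
Lemma vge_ev_coef m p : vge v m (ev p) -> forall i, p`_i != 0 -> m <= s * i%:Z.
Proof.
rewrite poly_atE => h i npi.
have ip : (i < size p)%N by rewrite ltnNge; apply: contra npi => /(nth_default 0)->.
have := vge_no_cancel _ h (Ordinal ip) => /=.
have [n1 <-] := place_term i npi; rewrite vge_neq0 //; apply=> j k jk nj nk.
have nj' : p`_j != 0 by apply: contraNneq nj => ->; rewrite rmorph0 mul0r.
have nk' : p`_k != 0 by apply: contraNneq nk => ->; rewrite rmorph0 mul0r.
have [_ ->] := place_term j nj'; have [_ ->] := place_term k nk'.
by apply: contra_neq jk => /(mulfI ns)[] /ord_inj.
Qed.

Lemma ev_eq0 p : (ev p == 0) = (p == 0).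
Proof.
apply/idP/idP => [/eqP h|/eqP->]; last by rewrite rmorph0.
apply/eqP/polyP => i; rewrite coef0; apply/eqP; apply: contraT => npi.
have := @vge_ev_coef (s * i%:Z + 1) p; rewrite h vge0 => /(_ isT i npi).
lia.
Qed.

Lemma place_ev p : p != 0 -> exists k : nat, v (ev p) = s * k%:Z.
Proof.
move=> np; have nep : ev p != 0 by rewrite ev_eq0.
apply: contrapT => nk.
suff : vge v (v (ev p) + 1) (ev p) by rewrite vge_neq0 //; lia.
have hge : vge v (v (ev p)) (ev p) by rewrite vge_neq0.
rewrite {2}poly_atE; apply: vge_sum => i _.
have [->|npi] := eqVneq p`_i 0; first by rewrite rmorph0 mul0r vge0.
have [n1 vi] := place_term i npi.
have := vge_ev_coef hge npi; rewrite vge_neq0 // vi le_eqVlt => /orP[/eqP e|].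
  by case: nk; exists i.
by rewrite lezD1.
Qed.

Section IncongruentFamily.
Variables (I : finType) (e : I -> K).
Hypotheses (ne : forall i, e i != 0)
  (ve : forall i j, i != j -> ~~ (s %| v (e i) - v (e j))%Z).

(** The order of [ev (p i)] is a multiple of [s], so the orders of the terms stay incongruent modulo
    [s] and hence distinct. *)
Lemma vge_combination (p : I -> {poly F}) m :
  vge v m (\sum_i ev (p i) * e i) -> forall i, vge v m (ev (p i) * e i).
Proof.
apply: vge_no_cancel => i j ij; rewrite !mulf_eq0 !negb_or !ne !andbT !ev_eq0.
move=> ni nj; rewrite !(placeM vP) ?ev_eq0 //.
have [k ->] := place_ev ni; have [l ->] := place_ev nj.
apply: contraNneq (ve ij) => h.
suff -> : v (e i) - v (e j) = s * (l%:Z - k%:Z) by rewrite dvdz_mulr.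
by rewrite mulrBr; move: h; lia.
Qed.

Lemma combination_uniq (p q : I -> {poly F}) :
  \sum_i ev (p i) * e i = \sum_i ev (q i) * e i -> p =1 q.
Proof.
move=> h i; apply/eqP; rewrite -subr_eq0 -ev_eq0.
have h0 : \sum_i ev (p i - q i) * e i = 0.
  rewrite (eq_bigr (fun i => ev (p i) * e i - ev (q i) * e i)).
    by rewrite sumrB h subrr.
  by move=> j _; rewrite rmorphB mulrBl.
suff : ev (p i - q i) * e i = 0 by move/eqP; rewrite mulf_eq0 (negPf (ne i)) orbF.
apply: vge_all => m; apply: (vge_combination (p := fun i => p i - q i)).
by rewrite h0 vge0.
Qed.

End IncongruentFamily.

(** The diagonal term [ev (N i i) * e i] of [z * e i] cannot cancel, so it has order at least
    [m + v (e i)]; division by [e i] leaves the diagonal entry. *)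
Lemma vge_mxtrace n (e : 'I_n -> K) (N : 'M[{poly F}]_n) z m :
  (forall i, e i != 0) ->
  (forall i j, i != j -> ~~ (s %| v (e i) - v (e j))%Z) ->
  (forall i, z * e i = \sum_j ev (N i j) * e j) ->
  vge v m z -> vge v m (ev (\tr N)).
Proof.
move=> ne ve hN hz; rewrite raddf_sum /=; apply: vge_sum => i _.
rewrite -(vge_divl m _ (ne i)).
have := vgeM hz (_ : vge v (v (e i)) (e i)); rewrite {1}/vge lexx orbT => /(_ isT).
by rewrite hN => /(vge_combination ne ve)/(_ i).
Qed.

End TransverseFunction.
End Place.

(** * Functions with a single pole *)

Section RegularFunctions.
Variables (F : fieldType) (K : fieldType) (iota : {rmorphism F -> K}).
Variables (pt : eqType) (v : pt -> K -> int).
Hypothesis vP : forall p, is_place iota (v p).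
Variable P : pt.

Definition regular (z : K) : Prop := forall p, p != P -> vge (v p) 0 z.

Lemma regularC c : regular (iota c).
Proof. by move=> p _; apply: vgeC (vP p) c. Qed.

Lemma regularB x y : regular x -> regular y -> regular (x - y).
Proof. by move=> hx hy p pP; apply: (vgeB (vP p)); [exact: hx|exact: hy]. Qed.

Lemma regularM x y : regular x -> regular y -> regular (x * y).
Proof. by move=> hx hy p pP; rewrite -[0]addr0 (vgeM (vP p)) ?hx ?hy. Qed.

Lemma regularX x k : regular x -> regular (x ^+ k).
Proof. by move=> hx p pP; rewrite (vge0X (vP p)) ?hx. Qed.

Lemma regular_poly_at x p : regular x -> regular (poly_at iota x p).
Proof. by move=> hx q qP; apply: (vge_poly_at (vP q)); exact: hx. Qed.

Lemma regular_sum (I : Type) (s : seq I) (x : I -> K) :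
  (forall i, regular (x i)) -> regular (\sum_(i <- s) x i).
Proof. by move=> hx p pP; apply: (vge_sum (vP p)) => i _; apply: hx. Qed.

Variables (a b : nat) (f y : K).
Hypotheses (nf : f != 0) (ny : y != 0) (vf : v P f = - a%:Z) (vy : v P y = - b%:Z).
Hypotheses (rf : regular f) (ry : regular y) (cab : coprime a b) (a_gt1 : (1 < a)%N).
Hypothesis min_pole : forall z, regular z -> z != 0 -> v P z < 0 -> v P z <= - a%:Z.
Local Notation ev := (poly_at iota f).

Let a_gt0 : (0 < a)%N. Proof. by lia. Qed.

Lemma pole_bezout : exists i j, (i * b = 1 + j * a)%N.
Proof.
have b_gt0 : (0 < b)%N.
  by case: (posnP b) cab a_gt1 => // -> ; rewrite /coprime gcdn0 => /eqP->.
have /(coprimeP _ b_gt0)[[i j] /= h] : coprime b a by rewrite coprime_sym.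
by exists i, j; lia.
Qed.

(* A regular function vanishing to order m > 0 at P would combine with f and y
   into a regular function with a simple pole at P. *)
Lemma regular_vanish z : regular z -> vge (v P) 1 z -> z = 0.
Proof.
move=> rz hz; apply: contrapT => /eqP nz.
have [i [j ij]] := pole_bezout.
have [m vz] : exists m : nat, v P z = m.+1%:Z.
  move: hz; rewrite vge_neq0 //; case: (v P z) => // -[|m] // _; by exists m.
(* With [v P z = m + 1] and [i * b = 1 + j * a], the order at [P] is [- i * b - a * m * j + (m + 1)
   * a * j = -1]. *)
pose x := y ^+ i * f ^+ (m * j) * z ^+ (a * j).
have nx : x != 0 by rewrite !mulf_neq0 ?expf_neq0.
have rx : regular x by apply: regularM; [apply: regularM|]; apply: regularX.
have vx : v P x = -1.
  rewrite !(placeM (vP P)) ?mulf_neq0 ?expf_neq0 // !(placeX (vP P)) // vf vy vz.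
  by rewrite !pmulrn !mulrzz; nia.
by have := min_pole rx nx; rewrite vx => /(_ isT); lia.
Qed.

(** Powers of [y] realize every residue class of pole orders, [b] being invertible modulo [a]. The
    least order in each class gives a generator over the polynomials in [f]. *)
Lemma minimal_pole_order (i : 'I_a) : exists w (n : nat),
  [/\ regular w, w != 0, v P w = - n%:Z, (n %% a)%N = i &
      forall z (m : nat), regular z -> z != 0 -> v P z = - m%:Z ->
        (m %% a)%N = i -> (n <= m)%N].
Proof.
pose A m := `[< exists w, [/\ regular w, w != 0, v P w = - m%:Z & (m %% a)%N = i] >].
have exA : exists m, A m.
  have [u [u' h]] := pole_bezout.
  exists (b * (u * i))%N; apply/asboolP; exists (y ^+ (u * i)); split.
  - exact: regularX.
  - by rewrite expf_neq0.
  - by rewrite (placeX (vP P)) // vy pmulrn mulrzz; lia.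
  - rewrite (_ : b * (u * i) = i + u' * i * a)%N; last by nia.
    by rewrite addnC modnMDl modn_small.
case: (ex_minnP exA) => n /asboolP[w [rw nw vw ni]] hmin.
exists w, n; split=> // z m rz nz vz mi.
by apply: hmin; apply/asboolP; exists z.
Qed.

(** By minimality of [n i], a regular [z] has the same order at [P] as some [f ^+ k * w i]; removing
    the leading term lowers the pole order. The descent ends because a regular function that
    vanishes at [P] is 0. *)
Lemma exists_regular_basis : exists w : 'I_a -> K,
  [/\ forall i, regular (w i), forall i, w i != 0,
      forall i j, i != j -> ~~ (- a%:Z %| v P (w i) - v P (w j))%Z &
      forall z, regular z -> exists c : 'I_a -> {poly F}, z = \sum_i ev (c i) * w i].
Proof.
have /choice[w /choice[n hw]] := minimal_pole_order.
exists w; split.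
- by move=> i; have [] := hw i.
- by move=> i; have [] := hw i.
- move=> i j ij; have [_ _ -> ni _] := hw i; have [_ _ -> nj _] := hw j.
  apply: contra ij => h; rewrite -val_eqE /= -ni -nj.
  have : (a%:Z %| (n j)%:Z - (n i)%:Z)%Z by move: h; rewrite !dvdzE abszN opprK addrC.
  by rewrite -eqz_mod_dvd !modz_nat eqz_nat eq_sym.
move=> z rz.
have [k hk] : exists k : nat, vge (v P) (- k%:Z) z.
  have [->|nz] := eqVneq z 0; first by exists 0%N; rewrite vge0.
  by exists `|v P z|%N; rewrite vge_neq0 //; lia.
elim/ltn_ind: k z rz hk => k IH z rz hk.
have [->|nz] := eqVneq z 0.
  by exists (fun=> 0); rewrite big1 // => i _; rewrite rmorph0 mul0r.
have vz0 : v P z <= 0.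
  rewrite leNgt; apply/negP => h; move/eqP: nz; apply; apply: regular_vanish => //.
  by rewrite /vge; apply/orP; right; lia.
have [m vz] : exists m : nat, v P z = - m%:Z by exists `|v P z|%N; lia.
pose i := Ordinal (ltn_pmod m a_gt0).
have [rw nw vw ni hmin] := hw i.
have nm := hmin z m rz nz vz erefl.
pose x := f ^+ ((m - n i) %/ a) * w i.
have hx : ((m - n i) %/ a * a = m - n i)%N.
  apply: divnK; rewrite -(eqn_mod_dvd _ nm); by apply/eqP; rewrite ni.
have nx : x != 0 by rewrite mulf_neq0 ?expf_neq0.
have vx : v P x = v P z.
  rewrite (placeM (vP P)) ?expf_neq0 // (placeX (vP P)) // vf vw vz pmulrn mulrzz.
  by move: hx nm; lia.
have [c nc hc] := leading_term (vP P) nz nx (esym vx).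
have rzx : regular (z - iota c * x).
  apply: regularB => //; apply: regularM; first exact: regularC.
  by apply: regularM => //; apply: regularX.
have [d hd] : exists d : 'I_a -> {poly F}, z - iota c * x = \sum_i ev (d i) * w i.
  case: m => [|m] in i rw nw vw ni hmin nm x hx nx vx vz hc rzx *.
    have -> : z - iota c * x = 0 by apply: regular_vanish => //; apply: vge_le hc; lia.
    by exists (fun=> 0); rewrite big1 // => j _; rewrite rmorph0 mul0r.
  apply: (IH m) => //; first by move: hk; rewrite vge_neq0 // vz; clear; lia.
  by apply: vge_le hc; lia.
pose d' j := d j + (if j == i then c%:P * 'X^((m - n i) %/ a) else 0).
exists d'; rewrite -[z](subrK (iota c * x)) hd.
transitivity (\sum_j (ev (d j) * w j + (if j == i then iota c * x else 0))).
  by rewrite big_split /= -big_mkcond big_pred1_eq.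
apply: eq_bigr => j _; rewrite /d' rmorphD mulrDl; case: eqP => [->|_].
  by rewrite rmorphM rmorphXn /= poly_atC poly_atX mulrA.
by rewrite rmorph0 mul0r.
Qed.

End RegularFunctions.

(** * Traces of functions with a single pole *)

(** A factor ['X - c] is split off from [q] and [T] simultaneously; powers of the other linear
    factors are coprime to it, so their divisibility survives. *)
Lemma dvdp_of_linear_powers (F : closedFieldType) (q T : {poly F}) : q != 0 ->
  (forall c k, ('X - c%:P) ^+ k %| q -> ('X - c%:P) ^+ k %| T) -> q %| T.
Proof.
have [n] := ubnP (size q); elim: n => // n IH in q T *.
rewrite ltnS => sq nq h.
have [s1|/closed_rootP[c]] := eqVneq (size q) 1%N.
  by move/eqP: s1; rewrite size_poly_eq1 => /eqp_dvdl ->; apply: dvd1p.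
rewrite -dvdp_XsubCl => cq.
have /dvdpP[T1 eT] : 'X - c%:P %| T by rewrite -['X - _]expr1; apply: h.
have /dvdpP[q1 eq1] := cq.
have nX : 'X - c%:P != 0 by rewrite polyXsubC_eq0.
have nq1 : q1 != 0 by apply: contraNneq nq => q0; rewrite eq1 q0 mul0r.
rewrite eq1 eT dvdp_mul2r //; apply: IH => //.
  apply: leq_trans sq; rewrite eq1 size_mul // size_XsubC addn2 /=.
  by rewrite ltnS.
move=> d k dk; have [dc|dc] := eqVneq d c.
  rewrite -(dvdp_mul2r _ _ nX) -eT dc -exprSr; apply: h.
  by rewrite eq1 exprSr dvdp_mul2r // -dc.
have cop : coprimep (('X - d%:P) ^+ k) ('X - c%:P).
  by apply: coprimep_expl; rewrite coprimep_XsubC root_XsubC eq_sym.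
by rewrite -(Gauss_dvdpl _ cop) -eT; apply: h; rewrite eq1 dvdp_mulr.
Qed.

Section Trace.
Variables (F : closedFieldType) (K : fieldType) (iota : {rmorphism F -> K}).
Variables (pt : eqType) (v : pt -> K -> int).
Hypothesis vP : forall p, is_place iota (v p).
Hypothesis vpoles : forall x, exists s : seq pt, forall p, p \notin s -> vge (v p) 0 x.
Variables (P : pt) (a : nat) (f : K).
Local Notation regular := (regular v P).
Local Notation ev := (poly_at iota f).
Hypotheses (a_gt0 : (0 < a)%N) (nf : f != 0) (vf : v P f = - a%:Z) (rf : regular f).
Hypothesis vanish : forall z, regular z -> vge (v P) 1 z -> z = 0.
Variable w : 'I_a -> K.
Hypotheses (rw : forall i, regular (w i)) (nw : forall i, w i != 0)
  (vw : forall i j, i != j -> ~~ (- a%:Z %| v P (w i) - v P (w j))%Z)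
  (span : forall z, regular z -> exists c : 'I_a -> {poly F}, z = \sum_i ev (c i) * w i).

Let na : - a%:Z != 0. Proof. by rewrite oppr_eq0; lia. Qed.
Let evE := ev_eq0 (vP P) nf vf na.

(** Matrix of the multiplication by [z] on the module of regular functions; its trace represents the
    trace of [z] over the field generated by [f]. Images are rows, whence the reversed product in
    [mul_matrixM]. *)
Definition mul_matrix (z : K) (M : 'M[{poly F}]_a) : Prop :=
  forall i, z * w i = \sum_j ev (M i j) * w j.

Lemma mul_matrix_exists z : regular z -> exists M, mul_matrix z M.
Proof.
move=> rz; have /choice[c hc] : forall i, exists c : 'I_a -> {poly F},
    z * w i = \sum_j ev (c j) * w j.
  by move=> i; apply: span; apply: (regularM vP).
by exists (\matrix_(i, j) c i j) => i; rewrite hc; under [RHS]eq_bigr do rewrite mxE.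
Qed.

Lemma mul_matrix_uniq z M N : mul_matrix z M -> mul_matrix z N -> M = N.
Proof.
move=> hM hN; apply/matrixP => i j.
have := hM i; rewrite hN => /(combination_uniq (vP P) nf vf na nw vw)/(_ j).
by move=> ->.
Qed.

Lemma mul_matrixM x z A B :
  mul_matrix x A -> mul_matrix z B -> mul_matrix (x * z) (B *m A).
Proof.
move=> hA hB i; rewrite -mulrA hB mulr_sumr.
under eq_bigr do rewrite mulrCA hA mulr_sumr.
rewrite exchange_big; apply: eq_bigr => k _ /=.
rewrite mxE rmorph_sum mulr_suml; apply: eq_bigr => j _.
by rewrite rmorphM mulrA.
Qed.

Lemma mul_matrixB x z A B :
  mul_matrix x A -> mul_matrix z B -> mul_matrix (x - z) (A - B).
Proof.
move=> hA hB i; rewrite mulrBl hA hB -sumrB; apply: eq_bigr => j _.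
by rewrite !mxE rmorphB mulrBl.
Qed.

Lemma mul_matrix_scalar p : mul_matrix (ev p) p%:M.
Proof.
move=> i; rewrite (bigD1 i) //= big1 ?addr0 => [|j ji].
  by rewrite mxE eqxx.
by rewrite mxE eq_sym (negPf ji) rmorph0 mul0r.
Qed.

Lemma mul_matrixZ p z A : mul_matrix z A -> mul_matrix (ev p * z) (p *: A).
Proof.
by move=> hA; have := mul_matrixM (mul_matrix_scalar p) hA; rewrite mul_mx_scalar.
Qed.

Lemma mul_matrix_sum (I : Type) (s : seq I) z A :
  (forall i, mul_matrix (z i) (A i)) ->
  mul_matrix (\sum_(i <- s) z i) (\sum_(i <- s) A i).
Proof.
move=> h; elim: s => [|i s IH].
  by move=> i; rewrite !big_nil mul0r big1 // => j _; rewrite mxE rmorph0 mul0r.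
move=> j; rewrite !big_cons mulrDl IH h -big_split; apply: eq_bigr => k _ /=.
by rewrite mxE rmorphD mulrDl.
Qed.

Lemma above_dec p c : p != P -> ~~ vge (v p) 1 (f - iota c) ->
  f - iota c != 0 /\ v p (f - iota c) = 0.
Proof.
move=> pP h; have n : f - iota c != 0 by apply: contraNneq h => ->; rewrite vge0.
split=> //; have : vge (v p) 0 (f - iota c).
  by apply: (vgeB (vP p)); [exact: rf|exact: (vgeC (vP p))].
by move: h; rewrite !vge_neq0 //; lia.
Qed.

(** Every point other than [P] lies above some [c], so a power of [f - c] cancels a pole there and
    creates none away from [P]. A pole at [P] itself is harmless and is dropped from the list. *)
Lemma clear_poles x : exists2 q, q != 0 & regular (ev q * x).
Proof.
have [s hs] := vpoles x.
have {}hs p : p != P -> p \notin s -> vge (v p) 0 x by move=> _; apply: hs.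
elim: s x hs => [|p s IH] x hs.
  exists 1; rewrite ?oner_eq0 // rmorph1 mul1r => p pP; exact: hs.
have [pP|pP] := eqVneq p P.
  apply: IH => q qP qs; apply: hs => //.
  by rewrite inE negb_or qs pP qP.
have [c hc] := vge_res (vP p) (rf pP).
pose N := `|v p x|%N.
have rc : regular (f - iota c) by apply: (regularB vP) => //; apply: (regularC vP).
have [|q nq rq] := IH ((f - iota c) ^+ N * x).
  move=> q qP qs; have [qp|qp] := eqVneq q p; last first.
    rewrite -[0]addr0 (vgeM (vP q)) //; first exact: (regularX vP _ rc).
    by apply: hs => //; rewrite inE negb_or qp.
  have [->|nx] := eqVneq x 0; first by rewrite mulr0 vge0.
  rewrite qp; have hN : vge (v p) N%:Z ((f - iota c) ^+ N).
    elim: (N) => [|k IHk]; first by rewrite expr0 (vge1 (vP p)).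
    by rewrite exprS -add1n PoszD (vgeM (vP p)).
  apply: (@vge_le _ _ _ (N%:Z + v p x)); first by rewrite /N; lia.
  by apply: (vgeM (vP p)) => //; rewrite vge_neq0.
exists (q * ('X - c%:P) ^+ N).
  by rewrite mulf_neq0 // expf_neq0 // polyXsubC_eq0.
by rewrite rmorphM rmorphXn /= poly_atXsubC -mulrA.
Qed.

Lemma regular_coprime_pole c k q x : ~~ root q c ->
  regular (ev (q * ('X - c%:P) ^+ k) * x) ->
  (forall p, p != P -> vge (v p) 1 (f - iota c) -> vge (v p) 0 x) ->
  regular (ev q * x).
Proof.
move=> nqc hr hc p pP.
have [fc|/(above_dec pP)[nfc vfc]] := boolP (vge (v p) 1 (f - iota c)).
  by rewrite -[0]addr0 (vgeM (vP p)) ?hc // (vge_poly_at (vP p)) ?rf.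
have := hr p pP; rewrite rmorphM rmorphXn /= poly_atXsubC mulrAC.
by rewrite (vge_unitX (vP p)).
Qed.

(* Some q1(f) / u with q1(c) != 0 is regular: it inverts u up to q1(f). *)
Lemma det_mul_matrix_unit c u U : mul_matrix u U -> u != 0 ->
  (forall p, p != P -> vge (v p) 1 (f - iota c) -> v p u = 0) ->
  (\det U).[c] != 0.
Proof.
move=> hU nu hu.
have [q nq rq] := clear_poles u^-1.
have [k [q1 /implyP/(_ nq) nq1 eq1]] := multiplicity_XsubC q c.
have rq1 : regular (ev q1 * u^-1).
  apply: (regular_coprime_pole (c := c) (k := k)); rewrite -?eq1 // => p pP fc.
  by rewrite vge_neq0 ?invr_eq0 // (placeV (vP p)) // hu.
have [V hV] := mul_matrix_exists rq1.
have := mul_matrixM hV hU; rewrite divfK // => hUV.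
have /(congr1 (fun M => (\det M).[c])) := mul_matrix_uniq (mul_matrix_scalar q1) hUV.
rewrite det_scalar det_mulmx hornerM horner_exp => h.
apply: contraNneq nq1 => U0; move/eqP: h; rewrite U0 mul0r.
by rewrite expf_eq0 => /andP[].
Qed.

(** If the fiber were empty, [(f - c)^-1] would be regular and vanish at [P]. *)
Lemma fiber_nonempty c : exists2 p, p != P & vge (v p) 1 (f - iota c).
Proof.
apply: contrapT => hn.
have {}hn p : p != P -> f - iota c != 0 /\ v p (f - iota c) = 0.
  by move=> pP; apply: above_dec => //; apply/negP => h; apply: hn; exists p.
have hfc : f - iota c != 0 /\ v P (f - iota c) = - a%:Z.
  rewrite -vf; apply: (placeD_lt (vP P)) => //.
  by rewrite (vgeN (vP P)); apply: vge_le (vgeC (vP P) c); rewrite vf; lia.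
have [nfc vfc] := hfc.
suff /eqP : (f - iota c)^-1 = 0 by rewrite invr_eq0 (negPf nfc).
apply: vanish.
  by move=> p /hn[n0 e]; rewrite vge_neq0 ?invr_eq0 // (placeV (vP p)) // e.
by rewrite vge_neq0 ?invr_eq0 // (placeV (vP P)) // vfc; lia.
Qed.

(* A nonzero eigenvalue l of M at c is impossible, as z - l is a unit above c. *)
Lemma trace_vanish c z M : mul_matrix z M ->
  (forall p, p != P -> vge (v p) 1 (f - iota c) -> vge (v p) 1 z) ->
  (\tr M).[c] = 0.
Proof.
move=> hM hz; pose Mc := map_mx (horner_eval c) M.
have no_eig l : l != 0 -> ~~ root (char_poly Mc) l.
  move=> nl; have hil : mul_matrix (z - iota l) (M - (l%:P)%:M).
    by apply: mul_matrixB => //; rewrite -(poly_atC iota f); apply: mul_matrix_scalar.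
  have hval p : p != P -> vge (v p) 1 (f - iota c) ->
      z - iota l != 0 /\ v p (z - iota l) = 0.
    move=> pP fc; rewrite -(opprB _ z) oppr_eq0.
    have hzp := hz p pP fc; have nil : iota l != 0 by rewrite fmorph_eq0.
    have [n1 v1] : iota l + (- z) != 0 /\ v p (iota l + (- z)) = v p (iota l).
      by apply: (placeD_lt (vP p)) => //; rewrite (placeC (vP p)) // (vgeN (vP p)).
    split=> //; rewrite -(mulN1r (iota l - z)) (placeM (vP p)) ?oppr_eq0 ?oner_eq0 //.
    by rewrite v1 (placeC (vP p)) // -(rmorphN1 iota) (placeC (vP p)) // oppr_eq0 oner_eq0.
  have [p0 p0P fc0] := fiber_nonempty c.
  have [nzl _] := hval p0 p0P fc0.
  have : (\det (M - (l%:P)%:M)).[c] != 0.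
    by apply: (det_mul_matrix_unit hil nzl) => p pP fc; have [] := hval p pP fc.
  rewrite -eigenvalue_root_char -[_.[c]]/(horner_eval c _) -det_map_mx.
  rewrite map_mxB map_scalar_mx /= /horner_eval hornerC -/Mc => dn.
  apply/eigenvalueP => -[x xM nx]; move/eqP: dn; apply; apply/eqP/det0P.
  by exists x => //; rewrite mulmxBr xM mul_mx_scalar subrr.
have [r er] := closed_field_poly_normal (char_poly Mc).
have {}er : char_poly Mc = \prod_(z <- r) ('X - z%:P).
  by rewrite {1}er (eqP (char_poly_monic _)) scale1r.
have r0 l : l \in r -> l = 0.
  move=> lr; apply/eqP; apply: contraT => /no_eig; rewrite er root_prod_XsubC.
  by rewrite lr.
(* All eigenvalues at [c] are 0, so the characteristic polynomial is a pure power; its coefficient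
   of degree [a - 1], which is minus the trace, is 0. *)
have eX : char_poly Mc = 'X^a.
  have := size_char_poly Mc; rewrite er size_prod_XsubC => -[<-].
  elim: (r) r0 => [|l s IH] h; first by rewrite big_nil expr0.
  rewrite big_cons /= exprS (h l) ?mem_head // subr0 IH // => l' l's.
  by apply: h; rewrite inE l's orbT.
have := char_poly_trace Mc a_gt0; rewrite eX coefXn.
have -> : (a.-1 == a) = false by lia.
move/eqP; rewrite eq_sym oppr_eq0 => /eqP; rewrite trace_map_mx.
by [].
Qed.

(* Order at least 1 - e at the points other than P, with e the ramification index of f. *)
Definition codifferent (x : K) : Prop := forall p c, p != P ->
  vge (v p) 1 (f - iota c) -> vge (v p) 1 ((f - iota c) * x).

Lemma codifferentM x z : codifferent x -> regular z -> codifferent (x * z).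
Proof.
by move=> hx rz p c pP fc; rewrite mulrA -[1]addr0 (vgeM (vP p)) ?hx ?rz.
Qed.

(** The quotient of [\tr M] by [q] is the trace of [x], which is thus a polynomial in [f].
    Divisibility is tested at each [c]: if [('X - c) ^+ k.+1] divides [q], then [ev q * x] is
    [(f - c) ^+ k] times a regular function vanishing above [c], whose trace supplies the missing
    factor. *)
Lemma dvdp_trace x q M : codifferent x -> q != 0 -> regular (ev q * x) ->
  mul_matrix (ev q * x) M -> q %| \tr M.
Proof.
move=> cx nq rq hM; apply: dvdp_of_linear_powers => // c [_|k]; first exact: dvd1p.
case/dvdpP => q1 eq1.
have eqx : ev q * x = ev (('X - c%:P) ^+ k) * (ev q1 * ((f - iota c) * x)).
  rewrite eq1 exprS !rmorphM /= poly_atXsubC; ring.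
have habove p : p != P -> vge (v p) 1 (f - iota c) ->
    vge (v p) 1 (ev q1 * ((f - iota c) * x)).
  move=> pP fc; rewrite -[1]add0r (vgeM (vP p)) ?cx //.
  by apply: (vge_poly_at (vP p)); apply: rf.
have rz : regular (ev q1 * ((f - iota c) * x)).
  move=> p pP; have [fc|/(above_dec pP)[nfc vfc]] := boolP (vge (v p) 1 (f - iota c)).
    by apply: vge_le (habove p pP fc).
  have := rq p pP; rewrite eqx mulrC rmorphXn /= poly_atXsubC.
  by rewrite (vge_unitX (vP p)).
have [M1 hM1] := mul_matrix_exists rz.
have /dvdpP[T eT] : 'X - c%:P %| \tr M1.
  by rewrite dvdp_XsubCl; apply/rootP; apply: trace_vanish hM1 habove.
have := mul_matrixZ (('X - c%:P) ^+ k) hM1; rewrite -eqx => /(mul_matrix_uniq hM) ->.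
by rewrite mxtraceZ eT; apply/dvdpP; exists T; rewrite exprSr; ring.
Qed.

End Trace.

(** * Traces and the Newton polygon *)

Lemma incongruent_powers (F K : fieldType) (iota : {rmorphism F -> K})
    (v : K -> int) (a : nat) (s t : int) (y : K) :
  is_place iota v -> `|s|%N = a -> coprime a `|t| -> y != 0 -> v y = t ->
  forall i j : 'I_a, i != j -> ~~ (s %| v (y ^+ i) - v (y ^+ j))%Z.
Proof.
move=> vP sa cat ny vy i j; apply: contra => h.
have : (s %| t * (i%:Z - j%:Z))%Z.
  by move: h; rewrite !(placeX vP) // vy !pmulrn !mulrzz mulrBr.
rewrite dvdzE abszM sa Gauss_dvdr //.
case: (posnP `|i%:Z - j%:Z|) => [e _|pos /(dvdn_leq pos)].
  by apply/eqP/val_inj => /=; lia.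
by have := ltn_ord i; have := ltn_ord j; lia.
Qed.

Section TraceForm.
Variables (F : closedFieldType) (K : fieldType) (iota : {rmorphism F -> K}).
Hypothesis char0 : forall n, n.+1%:R != 0 :> F.
Variables (pt : eqType) (v : pt -> K -> int).
Hypothesis vP : forall p, is_place iota (v p).
Hypothesis vpoles : forall x, exists s : seq pt, forall p, p \notin s -> vge (v p) 0 x.
Variables (P Q : pt) (a b m : nat) (f y : K).
Local Notation regular := (regular v P).
Local Notation ev := (poly_at iota f).
Hypotheses (nf : f != 0) (ny : y != 0).
Hypotheses (vPf : v P f = - a%:Z) (vPy : v P y = - b%:Z).
Hypotheses (vQf : v Q f = a%:Z) (vQy : v Q y = m%:Z).
Hypotheses (rf : regular f) (ry : regular y).
Hypotheses (cab : coprime a b) (cam : coprime a m) (a_gt1 : (1 < a)%N).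
Let a_gt0 : (0 < a)%N. Proof. by lia. Qed.
Let nsP : - a%:Z != 0. Proof. by rewrite oppr_eq0; lia. Qed.
Let nsQ : a%:Z != 0. Proof. by lia. Qed.
Let evE := ev_eq0 (vP P) nf vPf nsP.
Let nyX (i : 'I_a) : y ^+ i != 0. Proof. by rewrite expf_neq0. Qed.

Let distP : forall i j : 'I_a, i != j -> ~~ (- a%:Z %| v P (y ^+ i) - v P (y ^+ j))%Z.
Proof.
by apply: (incongruent_powers (vP P) _ _ ny vPy); rewrite abszN.
Qed.

Let distQ : forall i j : 'I_a, i != j -> ~~ (a%:Z %| v Q (y ^+ i) - v Q (y ^+ j))%Z.
Proof. exact: (incongruent_powers (vP Q) _ _ ny vQy). Qed.

Variable w : 'I_a -> K.
Hypotheses (rw : forall i, regular (w i)) (nw : forall i, w i != 0)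
  (vw : forall i j, i != j -> ~~ (- a%:Z %| v P (w i) - v P (w j))%Z)
  (span : forall z, regular z -> exists c : 'I_a -> {poly F}, z = \sum_i ev (c i) * w i).
Local Notation mul_matrix := (mul_matrix iota f w).
Local Notation "M ^ev" := (map_mx ev M) (at level 2).
Let W : 'cV[K]_a := \col_i w i.
Let E : 'cV[K]_a := \col_(i < a) y ^+ i.

Lemma mul_matrixE z M : mul_matrix z M <-> z *: W = M^ev *m W.
Proof.
split=> [h|h i].
  by apply/colP => i; rewrite !mxE h; apply: eq_bigr => j _; rewrite !mxE.
have /colP/(_ i) := h; rewrite !mxE => ->; by apply: eq_bigr => j _; rewrite !mxE.
Qed.

(** The determinant is nonzero because the powers of [y] have orders at [P] distinct modulo [a],
    hence are independent over the polynomials in [f]. *)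
Lemma exists_power_matrix : exists2 Y : 'M[{poly F}]_a, \det Y != 0 & E = Y^ev *m W.
Proof.
have /choice[c hc] : forall i : 'I_a, exists c : 'I_a -> {poly F},
    y ^+ i = \sum_j ev (c j) * w j.
  by move=> i; apply: span; apply: (regularX vP).
have eE : E = (\matrix_(i, j) c i j)^ev *m W.
  by apply/colP => i; rewrite !mxE hc; apply: eq_bigr => j _; rewrite !mxE.
exists (\matrix_(i, j) c i j) => //; apply/negP => /det0P[x nx hx].
move/eqP: nx; apply; apply/rowP => i; rewrite mxE.
apply: (combination_uniq (vP P) nf vPf nsP nyX distP (p := fun i => x 0 i) (q := fun=> 0)).
rewrite [RHS]big1 => [|j _]; last by rewrite rmorph0 mul0r.
have /matrixP/(_ 0 0) : x^ev *m E = 0.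
  by rewrite eE mulmxA -map_mxM hx map_mx0 mul0mx.
by rewrite !mxE => h; rewrite -[RHS]h; apply: eq_bigr => j _; rewrite !mxE.
Qed.

Lemma adj_power_matrix (Y : 'M[{poly F}]_a) :
  E = Y^ev *m W -> ev (\det Y) *: W = (\adj Y)^ev *m E.
Proof.
by move=> ->; rewrite mulmxA -map_mxM mul_adj_mx map_scalar_mx mul_scalar_mx.
Qed.

Lemma vge_mul_trace_P z M k : mul_matrix z M -> vge (v P) k z ->
  vge (v P) k (ev (\tr M)).
Proof. by move=> hM; apply: (vge_mxtrace (vP P) nf vPf nsP nw vw). Qed.

(* At Q the trace is read off the basis of powers of y, whose orders at Q are
   distinct modulo a. *)
Lemma vge_mul_trace_Q z M k : mul_matrix z M -> vge (v Q) k z ->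
  vge (v Q) k (ev (\tr M)).
Proof.
move=> hM hz; have [Y nd eE] := exists_power_matrix.
have ned : ev (\det Y) != 0 by rewrite evE.
(* This is [\det Y] times the conjugate of [M] by [Y], hence the matrix of [ev (\det Y) * z] on the
   powers of [y]. *)
pose N := Y *m M *m \adj Y.
have trN : \tr N = \det Y * \tr M.
  by rewrite mxtrace_mulC mulmxA mul_adj_mx mul_scalar_mx mxtraceZ.
have hN : (ev (\det Y) * z) *: E = N^ev *m E.
  rewrite /N !map_mxM -[RHS]mulmxA -adj_power_matrix // -scalemxAr -mulmxA.
  move/mul_matrixE: hM => <-.
  by rewrite -scalemxAr -eE scalerA.
have hN' (i : 'I_a) : ev (\det Y) * z * y ^+ i = \sum_j ev (N i j) * y ^+ j.
  have /colP/(_ i) := hN; rewrite !mxE => ->.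
  by apply: eq_bigr => j _; rewrite !mxE.
have hdz : vge (v Q) (k + v Q (ev (\det Y))) (ev (\det Y) * z).
  by rewrite mulrC (vge_divl (vP Q)).
have := vge_mxtrace (vP Q) nf vQf nsQ nyX distQ hN' hdz.
by rewrite trN rmorphM /= mulrC (vge_divl (vP Q)).
Qed.

(** The inverse of [z] is a combination of the powers of [y] over the rational functions of [f], so
    a nonzero polynomial in [f] is a combination of the [z * y ^+ j]. Its trace is [a] times itself,
    nonzero in characteristic 0, whereas the traces of all the terms vanish. *)
Lemma trace_form_nondegenerate z : regular z ->
  (forall (j : 'I_a) M, mul_matrix (z * y ^+ j) M -> \tr M = 0) -> z = 0.
Proof.
move=> rz htr; apply: contrapT => /eqP nz.
have [q nq rq] := clear_poles vP vpoles a_gt0 nf vPf rf z^-1.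
have [Y nd eE] := exists_power_matrix.
have [c hc] := span rq.
pose p := (\row_i c i) *m \adj Y.
have hp : ev (\det Y * q) = \sum_j ev (p 0 j) * (z * y ^+ j).
  have : (\row_i c i)^ev *m W = (ev q * z^-1)%:M.
    apply/matrixP => i j; rewrite !ord1 hc !mxE eqxx mulr1n.
    by apply: eq_bigr => k _; rewrite !mxE.
  move/(congr1 (fun x => ev (\det Y) *: x)).
  rewrite scalemxAr adj_power_matrix // mulmxA -map_mxM -/p => /matrixP/(_ 0 0).
  rewrite !mxE eqxx mulr1n => h.
  rewrite rmorphM /= -[ev q](divfK nz) mulrA -h mulr_suml.
  by apply: eq_bigr => j _; rewrite !mxE mulrAC mulrA.
have /choice[M hM] : forall j : 'I_a, exists M, mul_matrix (z * y ^+ j) M.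
  move=> j; apply: (mul_matrix_exists vP rw span); apply: (regularM vP) => //.
  exact: (regularX vP).
have hMj := mul_matrix_sum (index_enum 'I_a)
  (fun j => mul_matrixZ (p 0 j) (hM j)).
have := mul_matrix_scalar iota f w (\det Y * q); rewrite hp.
move=> /(mul_matrix_uniq vP a_gt0 nf vPf nw vw hMj)/(congr1 mxtrace).
rewrite raddf_sum big1 => [|j _]; last by rewrite /= mxtraceZ (htr _ _ (hM j)) mulr0.
rewrite mxtrace_scalar => /esym/eqP; rewrite -mulr_natl mulf_eq0 => /orP[|].
  rewrite -polyC_natr polyC_eq0 -[a]prednK //; exact/negP.
by rewrite mulf_eq0 (negPf nd) (negPf nq).
Qed.
End TraceForm.

(* Interior lattice points of the Newton polygon of the relation between f and y. *)
Definition triangle (a b m : nat) : {set 'I_a * 'I_b} :=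
  [set x : 'I_a * 'I_b | (x.1 * m < a * x.2)%N && (a * x.2 < x.1 * b)%N].

Section CodifferentBound.
Variables (F : closedFieldType) (K : fieldType) (iota : {rmorphism F -> K}).
Hypothesis char0 : forall n, n.+1%:R != 0 :> F.
Variables (pt : eqType) (v : pt -> K -> int).
Hypothesis vP : forall p, is_place iota (v p).
Hypothesis vpoles : forall x, exists s : seq pt, forall p, p \notin s -> vge (v p) 0 x.
Variables (P Q : pt) (a b m : nat) (f y : K).
Local Notation regular := (regular v P).
Local Notation ev := (poly_at iota f).
Hypotheses (QP : Q != P) (nf : f != 0) (ny : y != 0).
Hypotheses (vPf : v P f = - a%:Z) (vPy : v P y = - b%:Z).
Hypotheses (vQf : v Q f = a%:Z) (vQy : v Q y = m%:Z).
Hypotheses (rf : regular f) (ry : regular y).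
Hypotheses (cab : coprime a b) (cam : coprime a m) (a_gt1 : (1 < a)%N).
Hypothesis min_pole : forall z, regular z -> z != 0 -> v P z < 0 -> v P z <= - a%:Z.

Let a_gt0 : (0 < a)%N. Proof. by lia. Qed.
Let nsP : - a%:Z != 0. Proof. by rewrite oppr_eq0; lia. Qed.
Let nsQ : a%:Z != 0. Proof. by lia. Qed.
Let evE := ev_eq0 (vP P) nf vPf nsP.
Let vanish := regular_vanish vP nf ny vPf vPy rf ry cab a_gt1 min_pole.

(** The coefficients of the traces of the [phi k * y ^+ j] form a matrix with [g] rows and one
    column for each lattice point. A relation between its rows makes the traces of a combination of
    the [phi k] vanish, hence the combination itself. *)
Lemma codifferent_bound g (phi : 'I_g -> K) :
  (forall k, codifferent iota v P f (phi k)) ->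
  (forall k, vge (v P) (a%:Z + 1) (phi k)) ->
  (forall c : 'I_g -> F, \sum_k iota (c k) * phi k = 0 -> forall k, c k = 0) ->
  (g <= #|triangle a b m|)%N.
Proof.
move=> cphi Pphi indep.
have [w [rw nw vw span]] :=
  exists_regular_basis vP nf ny vPf vPy rf ry cab a_gt1 min_pole.
have Qphi k : vge (v Q) (1 - a%:Z) (phi k).
  have h : vge (v Q) 1 (f * phi k).
    have := cphi k Q 0 QP; rewrite rmorph0 subr0; apply.
    by rewrite vge_neq0 // vQf; lia.
  by rewrite -(vge_divl (vP Q) _ _ nf) mulrC vQf subrK.
have [q nq rq] : exists2 q, q != 0 & forall k, regular (ev q * phi k).
  have /choice[q hq] : forall k, exists q, q != 0 /\ regular (ev q * phi k).
    by move=> k; have [q] := clear_poles vP vpoles a_gt0 nf vPf rf (phi k); exists q.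
  exists (\prod_k q k) => [|k].
    by apply/prodf_neq0 => k _; have [] := hq k.
  have [_ rk] := hq k; rewrite (bigD1 k) //= rmorphM /= mulrAC.
  by apply: (regularM vP) => //; apply: (regular_poly_at vP).
have neq0 : ev q != 0 by rewrite evE.
have rz k (j : 'I_a) : regular (ev q * phi k * y ^+ j).
  by apply: (regularM vP) => //; apply: (regularX vP).
have hMex k (j : 'I_a) : exists M, mul_matrix iota f w (ev q * phi k * y ^+ j) M.
  exact: (mul_matrix_exists vP rw span).
pose M k (j : 'I_a) := sval (cid (hMex k j)).
have hM k (j : 'I_a) : mul_matrix iota f w (ev q * phi k * y ^+ j) (M k j) :=
  svalP (cid (hMex k j)).
(* Division by [q] recovers the trace: [R k j] is the trace of [phi k * y ^+ j], as a polynomial in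
   [f]. *)
have hRex k (j : 'I_a) : exists R, \tr (M k j) = R * q.
  apply/dvdpP; have hm := hM k j; have hr := rz k j; rewrite -mulrA in hm hr.
  apply: (dvdp_trace vP vpoles a_gt0 nf vPf rf vanish rw nw vw span _ nq hr hm).
  by apply: (codifferentM vP); [exact: cphi|exact: (regularX vP)].
pose R k (j : 'I_a) := sval (cid (hRex k j)).
have hR k (j : 'I_a) : \tr (M k j) = R k j * q := svalP (cid (hRex k j)).
(* At [P] the trace has order at least [a + 1 - b * j], which gives [a * i < b * j - a]; at [Q] it
   has order at least [1 - a + m * j], which gives [a * i > m * j - a]. So [i.+1], not [i], is the
   coordinate of the lattice point. *)
have Rsupp k (j : 'I_a) i : (R k j)`_i != 0 ->
    [/\ (i.+1 < b)%N, (j * m < a * i.+1)%N & (a * i.+1 < j * b)%N].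
  move=> nR; have hm := hM k j.
  have e : ev q * phi k * y ^+ j = phi k * y ^+ j * ev q by ring.
  have zP : vge (v P) (a%:Z + 1 - (b * j)%:Z + v P (ev q)) (ev q * phi k * y ^+ j).
    rewrite e (vge_divl (vP P)) //; apply: (vgeM (vP P)) => //.
    by rewrite vge_neq0 ?expf_neq0 // (placeX (vP P)) // vPy pmulrn mulrzz; lia.
  have zQ : vge (v Q) (1 - a%:Z + (m * j)%:Z + v Q (ev q)) (ev q * phi k * y ^+ j).
    rewrite e (vge_divl (vP Q)) //; apply: (vgeM (vP Q)) => //.
    by rewrite vge_neq0 ?expf_neq0 // (placeX (vP Q)) // vQy pmulrn mulrzz; lia.
  have := vge_mul_trace_P vP nf ny vPf vPy vQf vQy cab cam a_gt1 nw vw hm zP.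
  have := vge_mul_trace_Q vP nf ny vPf vPy vQf vQy ry cab cam a_gt1 span hm zQ.
  rewrite hR (rmorphM (poly_at iota f)) (vge_divl (vP Q)) // (vge_divl (vP P)) // => hQ hP.
  have := vge_ev_coef (vP P) nf vPf nsP hP nR.
  have := vge_ev_coef (vP Q) nf vQf nsQ hQ nR.
  move=> lQ lP; have h2 : (a * i.+1 < j * b)%N by move: lP; rewrite mulnS; clear; lia.
  split=> //; last by move: lQ; rewrite mulnS; clear; lia.
  rewrite -(ltn_pmul2l a_gt0); apply: leq_trans h2 _.
  by rewrite leq_mul2r ltnW ?orbT.
(* The lattice point [(j, i + 1)] carries the coefficient of degree [i], whence the predecessor. *)
pose A : 'M[F]_(g, #|triangle a b m|) :=
  \matrix_(k, s) let x : 'I_a * 'I_b := enum_val s in (R k x.1)`_(x.2.-1).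
suff /eqP <- : row_free A by exact: rank_leq_col.
apply: inj_row_free => u uA; apply/rowP => k; rewrite mxE.
apply: (indep (fun k => u 0 k)).
suff : \sum_k iota (u 0 k) * (ev q * phi k) = 0.
  under eq_bigr do rewrite mulrCA.
  by rewrite -mulr_sumr => /eqP; rewrite mulf_eq0 (negPf neq0) => /eqP.
apply: (trace_form_nondegenerate char0 vP vpoles nf ny vPf vPy vQf vQy rf ry
  cab cam a_gt1 rw nw vw span).
  apply: (regular_sum vP) => i; apply: (regularM vP) => //; exact: (regularC vP).
move=> j N hN.
have hsum := mul_matrix_sum (index_enum 'I_g)
  (fun k => mul_matrixZ (u 0 k)%:P (hM k j)).
have eN : N = \sum_k (u 0 k)%:P *: M k j.
  apply: (mul_matrix_uniq vP a_gt0 nf vPf nw vw hN).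
  move=> i; rewrite -hsum; congr (_ * _); rewrite mulr_suml.
  by apply: eq_bigr => l _; rewrite poly_atC !mulrA.
have -> : \tr N = (\sum_k (u 0 k)%:P * R k j) * q.
  rewrite eN raddf_sum mulr_suml; apply: eq_bigr => l _.
  by rewrite /= mxtraceZ hR mulrA.
suff -> : \sum_k (u 0 k)%:P * R k j = 0 by rewrite mul0r.
apply/polyP => i; rewrite coef0 coef_sum.
under eq_bigr do rewrite coefCM.
have [[l nl]|/forallNP hz] := pselect (exists l, (R l j)`_i != 0); last first.
  by rewrite big1 // => l _; have /negP := hz l; rewrite negbK => /eqP->; rewrite mulr0.
have [ib h1 h2] := Rsupp l j i nl.
have sT : (j, Ordinal ib) \in triangle a b m by rewrite inE /= h1.
have /matrixP/(_ 0 (enum_rank_in sT (j, Ordinal ib))) := uA.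
rewrite !mxE => h; rewrite -[RHS]h; apply: eq_bigr => l' _.
by rewrite !mxE enum_rankK_in.
Qed.

End CodifferentBound.


(** * Counting the lattice points of the triangle *)

Lemma divn_reflect (a c j : nat) : coprime a c -> (0 < j < a)%N ->
  ((j * c %/ a + (a - j) * c %/ a).+1 = c)%N.
Proof.
move=> cac /andP[j0 ja]; have a0 : (0 < a)%N by lia.
have nd : ~~ (a %| j * c)%N.
  by rewrite Gauss_dvdl //; apply/negP => /(dvdn_leq j0); lia.
have := divn_eq (j * c) a; have := divn_eq ((a - j) * c) a.
have := ltn_pmod (j * c) a0; have := ltn_pmod ((a - j) * c) a0.
(* The two remainders are below [a] and sum to a multiple of [a]; as the first is positive, the sum
   is [a]. *)
have : (0 < j * c %% a)%N by rewrite lt0n.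
have : (j * c + (a - j) * c = a * c)%N by rewrite -mulnDl subnKC // ltnW.
set u := (_ %/ a)%N; set u' := (_ %/ a)%N.
set s := (_ %% a)%N; set s' := (_ %% a)%N.
move=> e s0 s'a sa e' e''.
by nia.
Qed.

Lemma card_ord_interval (b l h : nat) : (#|[set i : 'I_b | (l < i <= h)%N]| <= h - l)%N.
Proof.
rewrite cardE -(size_map (@nat_of_ord b)) -(size_iota l.+1 (h - l)).
apply: uniq_leq_size; first by rewrite map_inj_uniq ?enum_uniq //; exact: ord_inj.
move=> x /mapP[j]; rewrite mem_enum inE => hj ->.
by rewrite mem_iota; lia.
Qed.

(** Row [j] has at most [j * b %/ a - j * m %/ a] points. By [divn_reflect] the bounds of the rows
    [j] and [a - j] add up to [(b - 1) - (m - 1) = b - m]; summing over [0 < j < a] counts every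
    nonempty row twice. *)
Lemma card_triangle (a b m : nat) : (m <= b)%N -> coprime a b -> coprime a m ->
  (2 * #|triangle a b m| <= (a - 1) * (b - m))%N.
Proof.
case: a => [|a] mb cab cam; first by rewrite (eq_card0 (A := triangle _ _ _)) // => -[[]].
pose F j := (j * b %/ a.+1 - j * m %/ a.+1)%N.
have hF : (#|triangle a.+1 b m| <= \sum_(j < a.+1) F j)%N.
  rewrite -sum1_card (eq_bigl (fun x : 'I_a.+1 * 'I_b =>
    (x.1 * m < a.+1 * x.2)%N && (a.+1 * x.2 < x.1 * b)%N)); last by move=> x; rewrite inE.
  rewrite -(pair_big_dep predT (fun (j : 'I_a.+1) (i : 'I_b) =>
    (j * m < a.+1 * i)%N && (a.+1 * i < j * b)%N) (fun _ _ => 1%N)) /=.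
  apply: leq_sum => j _; rewrite sum1_card.
  apply: leq_trans (card_ord_interval b (j * m %/ a.+1) (j * b %/ a.+1)).
  apply: subset_leq_card; apply/subsetP => i; rewrite unfold_in inE => /andP[h1 h2].
  by rewrite ltn_divLR // leq_divRL // [(i * _)%N]mulnC h1 ltnW.
have hs : (\sum_(j < a.+1) F j = \sum_(j < a) F j.+1)%N.
  by rewrite big_ord_recl /F !mul0n !div0n.
have hr : (\sum_(j < a) F j.+1 = \sum_(j < a) F (a.+1 - j.+1))%N.
  rewrite (reindex_inj rev_ord_inj) /=; apply: eq_bigr => j _.
  by congr F; have := ltn_ord j; lia.
have : (2 * \sum_(j < a.+1) F j <= a * (b - m))%N.
  rewrite mul2n -addnn {1}hs hs {2}hr -big_split /=.
  rewrite -[X in (_ <= X * _)%N]card_ord -sum_nat_const; apply: leq_sum => j _.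
  have ja : (0 < j.+1 < a.+1)%N by have := ltn_ord j; lia.
  have := divn_reflect cab ja; have := divn_reflect cam ja.
  have := leq_div2r a.+1 (leq_mul (leqnn j.+1) mb).
  have := leq_div2r a.+1 (leq_mul (leqnn (a.+1 - j.+1)) mb).
  rewrite /F; lia.
lia.
Qed.

(** * Derivations and places *)

Lemma rmorph_deriv_eq0 (R : idomainType) (p : {poly R}) :
  (forall n, n.+1%:R != 0 :> R) -> p^`() = 0 -> exists c, p = c%:P.
Proof.
move=> char0 p0; exists p`_0; apply/polyP => -[|i]; rewrite coefC //=.
have := congr1 (fun q : {poly R} => q`_i) p0; rewrite coef_deriv coef0 => /eqP.
by rewrite -mulr_natr mulf_eq0 (negPf (char0 i)) orbF => /eqP.
Qed.

Section Derivation.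
Variables (K : fieldType) (D : K -> K).
Hypotheses (derD : forall x y, D (x + y) = D x + D y)
           (derM : forall x y, D (x * y) = D x * y + x * D y).

Lemma der0 : D 0 = 0.
Proof. by apply: (addrI (D 0)); rewrite -derD !addr0. Qed.

Lemma der1 : D 1 = 0.
Proof.
by have := derM 1 1; rewrite !mulr1 mul1r => h; apply: (addrI (D 1)); rewrite addr0 -h.
Qed.

Lemma dlogM x y : x != 0 -> y != 0 -> D (x * y) / (x * y) = D x / x + D y / y.
Proof. by move=> nx ny; rewrite derM; field; rewrite nx ny. Qed.

Lemma dlogX x n : x != 0 -> D (x ^+ n) / x ^+ n = n%:R * (D x / x).
Proof.
move=> nx; elim: n => [|n IH]; first by rewrite expr0 der1 mul0r mul0r.
by rewrite exprS dlogM ?expf_neq0 // IH -{1}[D x / x]mul1r -mulrDl -natr1 addrC.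
Qed.

Lemma dlogV x : x != 0 -> D x^-1 / x^-1 = - (D x / x).
Proof.
move=> nx; apply/eqP; rewrite -addr_eq0 -dlogM ?invr_eq0 // mulVf // der1 mul0r.
by [].
Qed.

Lemma dlogXz x (e : int) : x != 0 -> D (x ^ e) / x ^ e = e%:~R * (D x / x).
Proof.
move=> nx; case: e => n; first by rewrite -exprnP dlogX.
by rewrite NegzE -exprnN dlogV ?expf_neq0 // dlogX // mulrNz mulNr.
Qed.

Lemma der_poly_at (R : comNzRingType) (iota : {rmorphism R -> K}) x p :
  (forall c, D (iota c) = 0) ->
  D (poly_at iota x p) = poly_at iota x p^`() * D x.
Proof.
move=> derC; elim/poly_ind: p => [|p c IH]; first by rewrite linear0 !rmorph0 mul0r der0.
rewrite derivD derivC derivM derivX mulr1 addr0.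
rewrite !rmorphD !rmorphM /= poly_atX poly_atC derD derM derC IH addr0.
by rewrite mulrDl mulrAC.
Qed.

Section Constants.
Variables (F : fieldType) (iota : {rmorphism F -> K}).
Hypotheses (derC : forall c, D (iota c) = 0) (char0 : forall n, n.+1%:R != 0 :> F).

(** As [D] kills the polynomials in [f], applying it to the relation shows that the derivative of
    [Q] at [y], times [D y], is 0. If the first factor vanishes, a relation of lower degree is left;
    it is nontrivial in characteristic 0, since [f] is transcendental. *)
Lemma der_algebraic f y (Q : {poly {poly F}}) :
  (forall p, poly_at iota f p = 0 -> p = 0) -> D f = 0 ->
  Q != 0 -> poly_at (poly_at iota f) y Q = 0 -> D y = 0.
Proof.
move=> ftr Df; have [m] := ubnP (size Q); elim: m => // m IH in Q *.
rewrite ltnS => sQ nQ Q0.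
have derf p : D (poly_at iota f p) = 0 by rewrite der_poly_at // Df mulr0.
have [/rmorph_deriv_eq0[]|nQ'] := eqVneq Q^`() 0.
- by move=> n; rewrite -polyC_natr polyC_eq0.
- by move=> c eQ; move: Q0 nQ; rewrite eQ poly_atC => /ftr ->; rewrite eqxx.
have := der_poly_at y Q derf; rewrite Q0 der0 => /esym/eqP.
rewrite mulf_eq0 => /orP[/eqP h|/eqP //].
apply: (IH Q^`()) => //; apply: leq_trans sQ; exact: lt_size_deriv.
Qed.

Variable v : K -> int.
Hypothesis vP : is_place iota v.
Variable t : K.
Hypotheses (nt : t != 0) (vt : v t = 1).

Lemma placeXz e : v (t ^ e) = e.
Proof.
case: e => n; first by rewrite -exprnP (placeX vP) // vt pmulrn mulrzz mul1r.
by rewrite NegzE -exprnN (placeV vP) ?expf_neq0 // (placeX vP) // vt pmulrn mulrzz mul1r.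
Qed.

Hypothesis der_bounded : exists M, forall x, vge v 0 x -> vge v M (D x).

(** A crude bound improves one unit at a time: for [x = c + u * t], [D x = D u * t + u * D t], and
    the factor [t] gains one order, up to the bound on [D t]. *)
Lemma der_vge_uniformizer m : vge v m (D t) -> forall x, vge v 0 x -> vge v m (D x).
Proof.
have [M hM] := der_bounded.
suff h k : forall m, m <= M + k%:Z -> vge v m (D t) -> forall x, vge v 0 x -> vge v m (D x).
  by apply: (h `|m - M|%N); lia.
elim: k => [|k IH] {}m hm ht x hx; first by apply: vge_le (hM x hx); lia.
have [c hc] := vge_res vP hx.
pose u := (x - iota c) / t.
have ex : x = iota c + u * t by rewrite divfK // addrC subrK.
have hu : vge v 0 u by rewrite -(vge_divl vP 0 u nt) vt add0r divfK.
rewrite ex derD derC add0r derM; apply: (vgeD vP).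
  rewrite -[m](subrK 1); apply: (vgeM vP); last by rewrite /vge vt lexx orbT.
  apply: IH => //; first by lia.
  by apply: vge_le ht; lia.
by rewrite -[m]add0r; apply: (vgeM vP).
Qed.

(* With h = u * t ^ e and D h = 1, the logarithmic derivative of h is h^-1, and its
   term e * D t / t dominates: so v (D t) = 1 - e. *)
Lemma der_vge h x : h != 0 -> v h != 0 -> D h = 1 -> vge v 0 x ->
  vge v (1 - v h) (D x).
Proof.
move=> nh vh Dh hx; pose e := v h; pose u := h / t ^ e.
have nte : t ^ e != 0 by rewrite expfz_neq0.
have nu : u != 0 by rewrite mulf_neq0 ?invr_eq0.
have vu : v u = 0 by rewrite (placeM vP) ?invr_eq0 // (placeV vP) // placeXz subrr.
have dlog : h^-1 = D u / u + e%:~R * (D t / t).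
  by rewrite -dlogXz // -dlogM // divfK // Dh mul1r.
have hu : vge v 0 u by rewrite vge_neq0 ?vu.
(* If [D t = 0], the previous lemma applies for every [m], so [D u = 0] and [h^-1] would be 0. *)
have [Dt|nDt] := eqVneq (D t) 0.
  have Du : D u = 0.
    by apply: (vge_all (v := v)) => m; apply: der_vge_uniformizer; rewrite ?Dt ?vge0.
  by move/eqP: dlog; rewrite Dt Du !mul0r mulr0 addr0 invr_eq0 (negPf nh).
have ne : e%:~R != 0 :> F.
  rewrite /e; case: (v h) vh => [[|k]|k] // _; first exact: char0.
  by rewrite NegzE mulrNz oppr_eq0; apply: char0.
have neK : e%:~R = iota e%:~R by rewrite rmorph_int.
have nie : e%:~R != 0 :> K by rewrite neK fmorph_eq0.
have nDtt : D t / t != 0 by rewrite mulf_neq0 ?invr_eq0.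
have vDt : v (e%:~R * (D t / t)) = v (D t) - 1.
  rewrite (placeM vP) // neK (placeC vP) // (placeM vP) ?invr_eq0 // (placeV vP) // vt.
  by rewrite add0r.
have hDu : vge v (v (D t)) (D u / u).
  rewrite -(vge_divl vP _ _ nu) vu addr0 divfK //.
  by apply: der_vge_uniformizer => //; rewrite /vge lexx orbT.
have [] := @placeD_lt _ _ _ _ vP (e%:~R * (D t / t)) (D u / u) _ _.
- by rewrite mulf_neq0.
- by rewrite vDt subrK.
rewrite addrC -dlog (placeV vP) // vDt => _ hv.
apply: der_vge_uniformizer => //; rewrite vge_neq0 //; move: hv; rewrite -/e; clear; lia.
Qed.

End Constants.
End Derivation.

(** * The place of a point *)

Section Evaluation.
Variables (F : closedFieldType) (K : fieldType) (cst : {rmorphism F -> K}).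

(* Evaluation at a point of the rational functions that are regular there, as a
   functional relation. *)
Record is_evaluation (ev : K -> F -> Prop) : Prop := IsEvaluation {
  evaluation_uniq : forall z c c', ev z c -> ev z c' -> c = c';
  evaluationC : forall c, ev (cst c) c;
  evaluationB : forall z z' c c', ev z c -> ev z' c' -> ev (z - z') (c - c');
  evaluationM : forall z z' c c', ev z c -> ev z' c' -> ev (z * z') (c * c');
  evaluationV : forall z c, ev z c -> c != 0 -> ev z^-1 c^-1;
  evaluation_fraction : forall z : K, exists x y c d,
    [/\ ev x c, ev y d, y != 0 & z = x / y] }.

Arguments evaluation_uniq {ev} _ {z c c'} _ _.
Arguments evaluationC {ev} _ c.
Arguments evaluationB {ev} _ {z z' c c'} _ _.
Arguments evaluationM {ev} _ {z z' c c'} _ _.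
Arguments evaluationV {ev} _ {z c} _ _.

Variable has_value : K -> F -> Prop.
Hypothesis evP : is_evaluation has_value.

Definition local_ring (z : K) : Prop := exists c, has_value z c.
Definition max_ideal (z : K) : Prop := has_value z 0.
Definition uniformizer (t : K) : Prop :=
  max_ideal t /\ forall z, max_ideal z -> exists2 u, local_ring u & z = u * t.

Lemma evaluationD z z' c c' : has_value z c -> has_value z' c' -> has_value (z + z') (c + c').
Proof.
move=> hz hz'; have := (evaluationB evP) hz ((evaluationB evP) ((evaluationC evP) 0) hz').
by rewrite rmorph0 !sub0r !opprK.
Qed.

Lemma evaluation_poly_at z c q : has_value z c ->
  has_value (poly_at cst z q) q.[c].
Proof.
move=> hz; elim/poly_ind: q => [|q e IH].
  by rewrite rmorph0 horner0 -(rmorph0 cst); apply: (evaluationC evP).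
rewrite rmorphD rmorphM /= poly_atX poly_atC hornerD hornerM hornerX hornerC.
by apply: evaluationD; [apply: (evaluationM evP)|apply: (evaluationC evP)].
Qed.

Lemma evaluation_poly_at2 z y c d (Q : {poly {poly F}}) :
  has_value z c -> has_value y d ->
  has_value (poly_at (poly_at cst z) y Q) (map_poly (horner_eval c) Q).[d].
Proof.
move=> hz hy; elim/poly_ind: Q => [|Q q IH].
  by rewrite !rmorph0 horner0 -(rmorph0 cst); apply: (evaluationC evP).
rewrite !rmorphD !rmorphM /= map_polyX map_polyC poly_atX poly_atC.
rewrite hornerD hornerM hornerX hornerC.
by apply: evaluationD; [apply: (evaluationM evP)|apply: evaluation_poly_at].
Qed.

Definition local_unit (z : K) : Prop := exists2 c, c != 0 & has_value z c.

Lemma local_unitP z : local_unit z <-> local_ring z /\ ~ max_ideal z.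
Proof.
split=> [[c nc hc]|[[c hc] hm]].
  split; first by exists c.
  by move=> /((evaluation_uniq evP) hc) c0; rewrite c0 eqxx in nc.
exists c => //; apply/eqP => c0; apply: hm.
by rewrite /max_ideal -c0.
Qed.

Lemma local_unit_neq0 z : local_unit z -> z != 0.
Proof.
move=> [c nc hc]; apply: contraNneq nc => z0; apply/eqP.
by apply: ((evaluation_uniq evP) hc); rewrite z0 -(rmorph0 cst); apply: (evaluationC evP).
Qed.

Lemma local_unitC c : c != 0 -> local_unit (cst c).
Proof. by exists c => //; apply: (evaluationC evP). Qed.

Lemma local_unit1 : local_unit 1.
Proof. by rewrite -(rmorph1 cst); apply: local_unitC; rewrite oner_eq0. Qed.

Lemma local_unitM y z : local_unit y -> local_unit z -> local_unit (y * z).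
Proof.
move=> [c nc hc] [d nd hd]; exists (c * d); first by rewrite mulf_neq0.
exact: (evaluationM evP).
Qed.

Lemma local_unitV z : local_unit z -> local_unit z^-1.
Proof.
by move=> [c nc hc]; exists c^-1; [rewrite invr_eq0|apply: (evaluationV evP)].
Qed.

Lemma local_unitXz z (e : int) : local_unit z -> local_unit (z ^ e).
Proof.
have X k y : local_unit y -> local_unit (y ^+ k).
  move=> hy; elim: k => [|k IH]; first by rewrite expr0; apply: local_unit1.
  by rewrite exprS; apply: local_unitM.
by move=> hz; case: e => k; [apply: X|apply/local_unitV/X].
Qed.

Lemma in_localM y z : local_ring y -> local_ring z -> local_ring (y * z).
Proof.
move=> [c hc] [d hd].
by exists (c * d); apply: (evaluationM evP).
Qed.

Lemma in_localD y z : local_ring y -> local_ring z -> local_ring (y + z).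
Proof.
move=> [c hc] [d hd].
by exists (c + d); apply: evaluationD.
Qed.

Lemma in_localC c : local_ring (cst c).
Proof. by exists c; apply: (evaluationC evP). Qed.

Lemma in_local_unit z : local_unit z -> local_ring z.
Proof. by case/local_unitP. Qed.

Lemma in_localX z k : local_ring z -> local_ring (z ^+ k).
Proof.
move=> hz; elim: k => [|k IH]; first by rewrite expr0; apply/in_local_unit/local_unit1.
by rewrite exprS; apply: in_localM.
Qed.

Lemma in_local_poly_at z q : local_ring z ->
  local_ring (poly_at cst z q).
Proof.
move=> [c hc]; exists q.[c].
exact: evaluation_poly_at.
Qed.

Lemma in_local_or z : local_ring z -> max_ideal z \/ local_unit z.
Proof.
move=> h; have [|nm] := pselect (max_ideal z); first by left.
by right; apply/local_unitP.
Qed.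

Lemma in_maxM y z : local_ring y -> max_ideal z -> max_ideal (y * z).
Proof.
move=> [c hc] h.
by rewrite /max_ideal -(mulr0 c); apply: (evaluationM evP).
Qed.

Lemma in_max_res z : local_ring z -> exists c, max_ideal (z - cst c).
Proof.
move=> [c hc]; exists c.
by rewrite /max_ideal -(subrr c); apply: (evaluationB evP) => //; apply: (evaluationC evP).
Qed.

Lemma in_max_not_unit z : max_ideal z -> ~ local_unit z.
Proof. by move=> h /local_unitP[]. Qed.

Lemma in_max_local z : max_ideal z -> local_ring z.
Proof. by move=> h; exists 0. Qed.


Hypothesis nonconstant : exists x : K, forall c, x <> cst c.
Hypothesis algebraic_dependence : forall x y : K,
  exists2 Q : {poly {poly F}}, Q != 0 & poly_at (poly_at cst x) y Q = 0.

(** As long as all coefficients of [Q] vanish at [c], the factor ['X - c] is divided out. Its value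
    [x - cst c] is nonzero, so the relation persists, while the size of the leading coefficient
    decreases. *)
Lemma algebraic_dependence_at (x y : K) c : x <> cst c ->
  exists2 Q : {poly {poly F}}, map_poly (horner_eval c) Q != 0 &
    poly_at (poly_at cst x) y Q = 0.
Proof.
move=> xc; have [Q nQ] := algebraic_dependence x y.
have [k] := ubnP (size (lead_coef Q)); elim: k => // k IH in Q nQ *.
rewrite ltnS => sk Q0; have [h|] := eqVneq (map_poly (horner_eval c) Q) 0; last by exists Q.
have /choice[q hq] i : exists q, Q`_i = q * ('X - c%:P).
  apply/dvdpP; rewrite dvdp_XsubCl; apply/rootP.
  by have := congr1 (fun q : {poly F} => q`_i) h; rewrite coef_map coef0.
pose Q1 := \poly_(i < size Q) q i.
have eQ : Q = ('X - c%:P) *: Q1.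
  apply/polyP => i; rewrite coefZ coef_poly; case: ltnP => hi.
    by rewrite hq mulrC.
  by rewrite mulr0 nth_default.
have nQ1 : Q1 != 0 by apply: contraNneq nQ => e; rewrite eQ e scaler0.
apply: (IH Q1) => //.
  apply: leq_trans sk; rewrite eQ lead_coefZ size_mul ?polyXsubC_eq0 ?lead_coef_eq0 //.
  by rewrite size_XsubC.
move: Q0; rewrite eQ -mul_polyC rmorphM /= poly_atC rmorphB /= poly_atX poly_atC => /eqP.
by rewrite mulf_eq0 subr_eq0 => /orP[/eqP/xc|/eqP].
Qed.

(** With [t = 0] the maximal ideal would be 0, the local ring would consist of constants, and so
    would its fraction field [K]. *)
Lemma uniformizer_neq0 t : uniformizer t -> t != 0.
Proof.
move=> [mt ht]; apply/eqP => t0; have [x hx] := nonconstant.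
have max0 z : max_ideal z -> z = 0 by move=> /ht[u _ ->]; rewrite t0 mulr0.
have loc z : local_ring z -> exists c, z = cst c.
  by move=> /in_max_res[c /max0/eqP]; rewrite subr_eq0 => /eqP->; exists c.
have [y [z [c' [d' [hy hz _ ex]]]]] := evaluation_fraction evP x.
have [[c ec] [d ed]] : (exists c, y = cst c) /\ (exists d, z = cst d).
  by split; apply: loc; [exists c'|exists d'].
by apply: (hx (c / d)); rewrite ex ec ed fmorph_div.
Qed.

(* Krull's intersection theorem, from the algebraic dependence of x and t. *)
Lemma uniformizer_power t x : uniformizer t -> local_ring x -> x != 0 ->
  exists (k : nat) u, local_unit u /\ x = u * t ^+ k.
Proof.
move=> ut lx nx; apply: contrapT => hn; have [mt ht] := ut.
have lt := in_max_local mt.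
have nt := uniformizer_neq0 ut.
(* If [x] is not a unit times a power of [t], then [t] can be divided out forever. *)
have div k : exists2 x', local_ring x' & x = x' * t ^+ k.
  elim: k => [|k [x' lx' ex]]; first by exists x; rewrite ?mulr1.
  have [/ht[u lu eu]|ux] := in_local_or lx'.
    by exists u => //; rewrite ex eu -mulrA exprS.
  by case: hn; exists k, x'.
have xc : x <> cst 0 by rewrite (rmorph0 cst); apply/eqP.
have [Q nQ Q0] := algebraic_dependence_at t xc.
have [w lw ew] : exists2 w, local_ring w &
    poly_at (poly_at cst x) t Q = poly_at cst t (map_poly (horner_eval 0) Q) + x * w.
  elim/poly_ind: (Q) => [|Q1 q [w lw ew]].
    by exists 0; rewrite ?rmorph0 ?mulr0 ?addr0 // -(rmorph0 cst); apply: in_localC.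
  have /factor_theorem[q' eq'] : root (q - q.[0]%:P) 0.
    by rewrite rootE hornerD hornerN hornerC subrr.
  exists (w * t + poly_at cst x q').
    by apply: in_localD; [apply: in_localM|apply: in_local_poly_at].
  rewrite !rmorphD !rmorphM /= map_polyX map_polyC !poly_atX !poly_atC /= ew.
  have -> : poly_at cst x q = poly_at cst x q' * x + cst q.[0].
    rewrite -[q in LHS](subrK q.[0]%:P) eq' rmorphD rmorphM /= poly_atC subr0.
    by rewrite poly_atX.
  by rewrite /horner_eval /=; ring.
(* Modulo [x] the relation is a polynomial in [t] alone, equal to [t ^+ k] times [h] at [t], where
   [h] is nonzero at 0. As [x] is divisible by [t ^+ k.+1], the value of [h] at [t] lies in the
   maximal ideal, a contradiction. *)
have [k [h /implyP/(_ nQ) nh eh]] := multiplicity_XsubC (map_poly (horner_eval 0) Q) 0.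
have [x' lx' ex] := div k.+1.
have ntk : t ^+ k != 0 by rewrite expf_neq0.
have eu : poly_at cst t h = (- x' * w) * t.
  apply: (mulIf ntk); move/eqP: ew; rewrite Q0 eh rmorphM rmorphXn /= subr0 poly_atX ex.
  by rewrite eq_sym addr_eq0 => /eqP ->; rewrite exprS; ring.
have /in_max_not_unit : max_ideal (poly_at cst t h).
  rewrite eu; apply: in_maxM => //; apply: in_localM => //.
  by rewrite -mulN1r -(rmorphN1 cst); apply: in_localM => //; apply: in_localC.
apply; exists h.[0]; first by [].
by apply: evaluation_poly_at.
Qed.

Definition has_order_at (z : K) (m : int) : Prop := exists t u,
  [/\ uniformizer t, local_ring u, ~ max_ideal u & z = u * t ^ m].

Lemma has_orderP z m : has_order_at z m <->
  exists t u, [/\ uniformizer t, local_unit u & z = u * t ^ m].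
Proof.
split=> [[t [u [ut lu mu e]]]|[t [u [ut /local_unitP[lu mu] e]]]].
  by exists t, u; split=> //; apply/local_unitP.
by exists t, u.
Qed.

Lemma uniformizer_order t u u' m m' : uniformizer t ->
  local_unit u -> local_unit u' -> u * t ^ m = u' * t ^ m' -> m = m'.
Proof.
move=> ut; have nt := uniformizer_neq0 ut; have [mt _] := ut.
wlog : u u' m m' / m <= m' => [hw lu lu' e|].
  by have [h|/ltW h] := leP m m'; [exact: (hw u u')|apply/esym/(hw u' u)].
rewrite le_eqVlt => /orP[/eqP//|h] lu lu' e; exfalso.
have [k hk] : exists k : nat, m' = m + k.+1%:Z by exists (absz (m' - m - 1)%R); lia.
have eu : u = u' * t ^+ k * t.
  apply: (mulIf (_ : t ^ m != 0)); first by rewrite expfz_neq0.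
  by rewrite e hk expfzDr // -exprnP exprS; ring.
have : max_ideal u.
  rewrite eu; apply: in_maxM => //; apply: in_localM; first exact: in_local_unit.
  by apply: in_localX; apply: in_max_local.
by move=> /in_max_not_unit.
Qed.

(** Two uniformizers are multiples of each other in the local ring, hence differ by a unit; so the
    order does not depend on the uniformizer. *)
Lemma has_order_for t z m : uniformizer t -> has_order_at z m ->
  exists2 u, local_unit u & z = u * t ^ m.
Proof.
move=> ut /has_orderP[t' [u [ut' lu ->]]].
have [mt ht] := ut; have [mt' ht'] := ut'.
have [w lw ew] := ht t' mt'; have [w' lw' ew'] := ht' t mt.
have nt := uniformizer_neq0 ut.
have w'w : w' * w = 1 by apply: (mulIf nt); rewrite mul1r -mulrA -ew -ew'.
have uw : local_unit w.
  case: (in_local_or lw) => // mw; have := in_maxM lw' mw; rewrite w'w.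
  by move=> /in_max_not_unit; case; apply: local_unit1.
exists (u * w ^ m); first by apply: local_unitM => //; apply: local_unitXz.
by rewrite ew expfzMl mulrA.
Qed.

Lemma has_order_uniq z m m' : has_order_at z m -> has_order_at z m' -> m = m'.
Proof.
move=> h h'; have /has_orderP[t [u [ut lu e]]] := h.
have [u' lu' e'] := has_order_for ut h'.
by apply: (uniformizer_order ut lu lu'); rewrite -e -e'.
Qed.

(** The default 0 is the value at [z = 0]: once a uniformizer exists, every nonzero function has an
    order. *)
Definition ord (z : K) : int :=
  if pselect (exists m, has_order_at z m) is left e then sval (cid e) else 0.

Lemma ordE z m : has_order_at z m -> ord z = m.
Proof.
move=> h; rewrite /ord; case: pselect => [e|[]]; last by exists m.
exact: has_order_uniq (svalP (cid e)) h.
Qed.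

Hypothesis unif : exists t, uniformizer t.

Lemma has_order_ord z : z != 0 -> has_order_at z (ord z).
Proof.
move=> nz; have [t ut] := unif; have nt := uniformizer_neq0 ut.
have [x [y [c [d [hx hy ny ez]]]]] := evaluation_fraction evP z.
have lx : local_ring x by exists c.
have ly : local_ring y by exists d.
have nx : x != 0 by apply: contraNneq nz => x0; rewrite ez x0 mul0r.
have [k [u [uu ex]]] := uniformizer_power ut lx nx.
have [l [w [uw ey]]] := uniformizer_power ut ly ny.
have h : has_order_at z (k%:Z - l%:Z).
  apply/has_orderP; exists t, (u * w^-1); split=> //.
    by apply: local_unitM => //; apply: local_unitV.
  by rewrite ez ex ey expfzDr // -exprnP -exprnN -mulf_div.
by rewrite (ordE h).
Qed.

Lemma ord_for t z : uniformizer t -> z != 0 ->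
  exists2 u, local_unit u & z = u * t ^ ord z.
Proof. by move=> ut nz; apply: has_order_for ut (has_order_ord nz). Qed.

Lemma ordP t u z m : uniformizer t -> local_unit u -> z = u * t ^ m ->
  ord z = m.
Proof. by move=> ut lu e; apply: ordE; apply/has_orderP; exists t, u. Qed.

Lemma in_local_ord z : local_ring z <-> vge ord 0 z.
Proof.
have [t ut] := unif; have [mt _] := ut; have [->|nz] := eqVneq z 0.
  by rewrite vge0; split=> // _; rewrite -(rmorph0 cst); apply: in_localC.
rewrite vge_neq0 //; split=> [lz|].
  have [k [u [lu e]]] := uniformizer_power ut lz nz.
  by rewrite (@ordP t u z k%:Z).
move=> vz; have [u lu ->] := ord_for ut nz.
have [k ->] : exists k : nat, ord z = k%:Z by exists (absz (ord z)); lia.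
by apply: in_localM; [apply: in_local_unit|apply/in_localX/in_max_local].
Qed.

Lemma in_max_ord z : max_ideal z <-> vge ord 1 z.
Proof.
have [t ut] := unif; have [mt ht] := ut; have nt := uniformizer_neq0 ut.
have [->|nz] := eqVneq z 0.
  rewrite vge0; split=> // _.
  by rewrite -(rmorph0 cst); apply: (evaluationC evP).
rewrite vge_neq0 //; split=> [mz|].
  have [w lw ew] := ht z mz.
  have nw : w != 0 by apply: contraNneq nz => w0; rewrite ew w0 mul0r.
  have [k [u [lu e]]] := uniformizer_power ut lw nw.
  by rewrite (@ordP t u z k.+1%:Z) // ew e -exprnP exprSr mulrA.
move=> vz; have [u lu ->] := ord_for ut nz.
have [k ->] : exists k : nat, ord z = k.+1%:Z by exists (absz (ord z)).-1; lia.
rewrite -exprnP exprSr mulrA; apply: in_maxM => //.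
by apply: in_localM; [apply: in_local_unit|apply/in_localX/in_max_local].
Qed.

Lemma ord_uniformizer t : uniformizer t -> ord t = 1.
Proof. by move=> ut; apply: (ordP ut local_unit1); rewrite mul1r. Qed.

Lemma ord_is_place : is_place cst ord.
Proof.
have [t ut] := unif; have [mt ht] := ut; have nt := uniformizer_neq0 ut.
split.
- move=> x y nx ny; have [u lu ex] := ord_for ut nx; have [w lw ey] := ord_for ut ny.
  apply: (ordP ut (local_unitM lu lw)).
  by rewrite {1}ex {1}ey expfzDr //; ring.
- suff h (x y : K) : x != 0 -> y != 0 -> x + y != 0 -> ord x <= ord y ->
      ord x <= ord (x + y).
    move=> x y nx ny nxy; have [hxy|/ltW hxy] := leP (ord x) (ord y).
      by rewrite h.
    by rewrite addrC [X in _ || X]h ?orbT // addrC.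
  move=> nx ny nxy hxy; have [u lu ex] := ord_for ut nx; have [w lw ey] := ord_for ut ny.
  have [k hk] : exists k : nat, ord y = ord x + k%:Z.
    by exists (absz (ord y - ord x)%R); lia.
  pose s := u + w * t ^+ k.
  have exy : x + y = s * t ^ ord x.
    by rewrite {1}ex {1}ey hk expfzDr // -exprnP /s; ring.
  have ns : s != 0 by apply: contraNneq nxy => s0; rewrite exy s0 mul0r.
  have ls : local_ring s.
    apply: in_localD; first exact: in_local_unit.
    by apply: in_localM; [apply: in_local_unit|apply/in_localX/in_max_local].
  have [l [u' [lu' es]]] := uniformizer_power ut ls ns.
  rewrite (@ordP t u' (x + y) (l%:Z + ord x)) //; first by lia.
  by rewrite exy es expfzDr // -exprnP mulrA.
- move=> c nc; apply: (ordP ut (local_unitC nc)).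
  by rewrite expr0z mulr1.
- move=> x nx vx.
  have lx : local_ring x by apply/in_local_ord; rewrite vge_neq0 ?vx.
  have [c /in_max_ord] := in_max_res lx; rewrite /vge subr_eq0.
  by move=> /orP[/eqP ->|h]; exists c; [left|right].
Qed.

End Evaluation.

(** * Regular differentials and the adapted function *)

Lemma mmap_closed (n : nat) (R : nzRingType) (S : nzRingType) (f : R -> S)
    (h : 'I_n -> S) (A : S -> Prop) (U : {mpoly R[n]}) :
  A 0 -> A 1 -> (forall x y, A x -> A y -> A (x + y)) ->
  (forall x y, A x -> A y -> A (x * y)) ->
  (forall c, A (f c)) -> (forall i, A (h i)) -> A (mmap f h U).
Proof.
move=> A0 A1 AD AM Af Ah; rewrite /mmap; apply: (big_ind A) => // m _.
refine (AM _ _ (Af _) _); rewrite /mmap1; apply: (big_ind A); [exact: A1|exact: AM|move=> i _].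
by elim: (m i) => [|k IH]; [rewrite expr0|rewrite exprS; exact: AM].
Qed.

Section Curve.
Variables (F : closedFieldType) (K : fieldType) (cst : {rmorphism F -> K}).
Hypothesis char0 : forall n, n.+1%:R != 0 :> F.
Variables (pt : choiceType) (has_value : pt -> K -> F -> Prop).
Hypothesis evP : forall p, is_evaluation cst (has_value p).
Hypothesis nonconstant : exists x : K, forall c, x <> cst c.
Hypothesis algebraic_dependence : forall x y : K,
  exists2 Q : {poly {poly F}}, Q != 0 & poly_at (poly_at cst x) y Q = 0.
Hypothesis unif : forall p, exists t, uniformizer (has_value p) t.
Hypothesis finite_zeros : forall z : K, z != 0 ->
  exists s : seq pt, forall p, has_value p z 0 -> p \in s.
Local Notation v := (fun p => ord (has_value p)).

Lemma curve_place p : is_place cst (ord (has_value p)).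
Proof. exact: (ord_is_place (evP p) nonconstant algebraic_dependence (unif p)). Qed.

Lemma local_vge p z : local_ring (has_value p) z <-> vge (ord (has_value p)) 0 z.
Proof. exact: (in_local_ord (evP p) nonconstant algebraic_dependence (unif p)). Qed.

Lemma max_vge p z : has_value p z 0 <-> vge (ord (has_value p)) 1 z.
Proof. exact: (in_max_ord (evP p) nonconstant algebraic_dependence (unif p)). Qed.

Lemma finite_poles x : exists s : seq pt, forall p, p \notin s -> vge (v p) 0 x.
Proof.
have [->|nx] := eqVneq x 0; first by exists [::] => p _; apply: vge0.
have nVx : x^-1 != 0 by rewrite invr_eq0.
have [s hs] := finite_zeros nVx; exists s => p; apply: contraNT => h.
apply: hs; apply/max_vge; move: h.
by rewrite !vge_neq0 // (placeV (curve_place p)) //; lia.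
Qed.

Lemma principal_divisor (u : K) : u != 0 ->
  exists D : {freeg pt / int}, forall q, coeff q D = v q u.
Proof.
move=> nu; have nVu : u^-1 != 0 by rewrite invr_eq0.
have [s hs] := finite_poles u; have [s' hs'] := finite_poles u^-1.
pose S := undup (s ++ s').
exists (\sum_(p <- S) << v p u *g p >>) => q.
rewrite raddf_sum /=; under eq_bigr do rewrite coeffU.
have [qS|qS] := boolP (q \in S).
  rewrite (bigD1_seq q) ?undup_uniq //= eqxx mulr1 big1 ?addr0 // => p /negPf->.
  by rewrite mulr0.
rewrite big_seq big1 => [|p pS]; last first.
  have [pq|_] := eqVneq p q; first by rewrite -pq pS in qS.
  by rewrite mulr0.
move: qS; rewrite mem_undup mem_cat negb_or => /andP[/hs + /hs'].
by rewrite !vge_neq0 // (placeV (curve_place q)) //; lia.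
Qed.

(** [E] is the divisor of zeros of [z - cst c], where [c] is chosen such that this function does not
    vanish at [p]. For [p = P] the coefficient is 0 because the pole has order exactly [m.+1]. *)
Lemma pole_base_point_free P z m : regular v P z -> z != 0 -> v P z = - m.+1%:Z ->
  forall p, exists E : {freeg pt / int},
    [/\ forall q, 0 <= coeff q E,
        exists2 u : K, u != 0 & forall q,
          has_order_at (has_value q) u (coeff q (E - << m.+1%:Z *g P >>)) &
        coeff p E = 0].
Proof.
move=> rz nz vz p; have plP := curve_place P; have pl := curve_place p.
have [c hc] : exists c, p != P -> v p (z - cst c) = 0.
  have [_|pP] := eqVneq p P; first by exists 0.
  have [c0 hc0] := vge_res pl (rz p pP); exists (c0 - 1) => _.
  have -> : z - cst (c0 - 1) = 1 + (z - cst c0) by rewrite rmorphB rmorph1; ring.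
  have [||_ ->] := placeD_lt pl (x := 1) (y := z - cst c0); last exact: (place1 pl).
    exact: oner_neq0.
  by rewrite (place1 pl) add0r.
pose u := z - cst c.
have [nu vu] : u != 0 /\ v P u = - m.+1%:Z.
  rewrite -vz; apply: (placeD_lt plP) => //; rewrite (vgeN plP).
  by apply: vge_le (vgeC plP c); rewrite vz; lia.
have ru : regular v P u.
  by apply: (regularB curve_place) => //; apply: (regularC curve_place).
have [D hD] := principal_divisor nu.
exists (D + << m.+1%:Z *g P >>); split.
- move=> q; rewrite coeffD hD coeffU; have [<-|Pq] := eqVneq P q.
    by rewrite vu mulr1 addNr.
  by rewrite mulr0 addr0; have := ru q; rewrite eq_sym vge_neq0 //; apply.
- exists u => // q; rewrite addrK hD.
  exact: (has_order_ord (evP q) nonconstant algebraic_dependence (unif q) nu).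
- rewrite coeffD hD coeffU; have [<-|Pp] := eqVneq P p.
    by rewrite vu mulr1 addNr.
  by rewrite mulr0 addr0 hc // eq_sym.
Qed.

Lemma base_point_free_function P m (E : {freeg pt / int}) (u : K) :
  (forall q, 0 <= coeff q E) ->
  (forall q, has_order_at (has_value q) u (coeff q (E - << m%:Z *g P >>))) ->
  coeff P E = 0 -> v P u = - m%:Z /\ forall q, q != P -> vge (v q) 0 u.
Proof.
move=> Epos hu EP; have vu q : v q u = coeff q E - m%:Z * (P == q)%:R.
  by rewrite (ordE (evP q) nonconstant (hu q)) coeffB coeffU.
split; first by rewrite vu EP eqxx mulr1 sub0r.
by move=> q qP; rewrite /vge vu [P == q]eq_sym (negPf qP) mulr0 subr0 Epos orbT.
Qed.

Section Derivations.
Local Notation is_der D := [/\ forall x y : K, D (x + y) = D x + D y,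
      forall x y : K, D (x * y) = D x * y + x * D y & forall c, D (cst c) = 0].

(** Supplies the crude bound from which [der_vge] starts. The Leibniz rule carries a common bound
    for the [D (x j)] over to polynomials in the generators, then to quotients whose denominator is
    a unit at [p]. *)
Lemma derivation_bounded p N (x : 'I_N -> K) (D : K -> K) : is_der D ->
  (forall j, local_ring (has_value p) (x j)) ->
  (forall z, local_ring (has_value p) z -> exists U V : {mpoly F[N]},
     (exists2 c, c != 0 & has_value p (mmap cst x V) c) /\
     z * mmap cst x V = mmap cst x U) ->
  exists M, forall z, vge (v p) 0 z -> vge (v p) M (D z).
Proof.
move=> [DD DM DC] hx gen; pose M : int := - (\sum_j absz (v p (D (x j))))%:Z.
have pl := curve_place p.
have M0 : M <= 0 by rewrite /M; lia.
have hM j : vge (v p) M (D (x j)).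
  have [->|nz] := eqVneq (D (x j)) 0; first exact: vge0.
  by rewrite vge_neq0 // /M (bigD1 j) //=; lia.
have poly U : vge (v p) 0 (mmap cst x U) /\ vge (v p) M (D (mmap cst x U)).
  apply: (@mmap_closed _ _ _ cst x (fun z => vge (v p) 0 z /\ vge (v p) M (D z))).
  - by rewrite (der0 DD) !vge0.
  - by rewrite (der1 DM) vge0 (vge1 pl).
  - by move=> y z [hy hDy] [hz hDz]; rewrite DD !(vgeD pl).
  - move=> y z [hy hDy] [hz hDz]; split; first by rewrite -[0]addr0 (vgeM pl).
    rewrite DM; apply: (vgeD pl); first by rewrite -[M]addr0 (vgeM pl).
    by rewrite -[M]add0r (vgeM pl).
  - by move=> c; rewrite DC vge0 (vgeC pl).
  - by move=> j; split=> //; apply/local_vge.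
exists M => z hz; have [U [V [[c nc hc] e]]] := gen z (proj2 (local_vge p z) hz).
have [hU hDU] := poly U; have [hV hDV] := poly V.
have uV : local_unit (has_value p) (mmap cst x V) by exists c.
have nV := local_unit_neq0 (evP p) uV.
have vV : v p (mmap cst x V) = 0.
  apply/eqP; rewrite eq_le; move: hV; rewrite vge_neq0 // => -> /=; rewrite andbT.
  rewrite leNgt; apply/negP => h; have /max_vge : vge (v p) 1 (mmap cst x V).
    by rewrite vge_neq0.
  by move=> /(in_max_not_unit (evP p)) /(_ uV).
rewrite -(vge_divl pl _ _ nV) vV addr0.
have -> : D z * mmap cst x V = D (mmap cst x U) - z * D (mmap cst x V).
  by rewrite -e DM addrK.
by apply: (vgeB pl) => //; rewrite -[M]add0r (vgeM pl).
Qed.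

Lemma derivation_unique f D : (forall p, poly_at cst f p = 0 -> p = 0) ->
  is_der D -> D f = 0 -> forall x, D x = 0.
Proof.
move=> ftr [DD DM DC] Df x; have [Q nQ Q0] := algebraic_dependence f x.
exact: (der_algebraic DD DM DC char0 ftr Df nQ Q0).
Qed.

(** Derivations form a line over [K], each being determined by its value at [f]. The one with
    [D f = 1] is differentiation along [f]: it evaluates a differential [phi df] to [phi]. *)
Lemma normalized_derivation f D0 x0 : (forall p, poly_at cst f p = 0 -> p = 0) ->
  is_der D0 -> D0 x0 <> 0 -> exists D, [/\ is_der D, D f = 1 &
    forall D', is_der D' -> forall x, D' x = D' f * D x].
Proof.
move=> ftr hD0 nx0; have [DD DM DC] := hD0.
have nDf : D0 f != 0.
  by apply/eqP => Df; apply: nx0; apply: (derivation_unique ftr hD0 Df).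
exists (fun x => D0 x / D0 f); split.
- split=> [x y|x y|c].
  + by rewrite DD mulrDl.
  + by rewrite DM mulrDl mulrAC mulrA.
  + by rewrite DC mul0r.
- by rewrite divff.
move=> D' [D'D D'M D'C] x; apply/eqP; rewrite -subr_eq0; apply/eqP.
apply: (derivation_unique (f := f) (D := fun x => D' x - D' f * (D0 x / D0 f)) ftr).
  split=> [y z|y z|c].
  + by rewrite DD D'D; ring.
  + by rewrite DM D'M; ring.
  + by rewrite DC D'C mul0r mulr0 subr0.
by rewrite divff // mulr1 subrr.
Qed.

End Derivations.

(** * Bound for the number of independent regular differentials *)

Section Bound.
Variables (P Q : pt) (a b n r : nat) (f y0 h : K) (nongap : nat -> Prop).
Local Notation regular := (regular v P).
Local Notation ev := (poly_at cst f).
Hypotheses (QP : Q != P) (hab : coprime a b) (hb : (b = n * a + r)%N)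
  (hn : (1 <= n)%N)  (hr : (1 <= r <= a - 1)%N).
Hypotheses (nf : f != 0) (vPf : v P f = - a%:Z) (vQf : v Q f = a%:Z) (rf : regular f).
Hypotheses (ny0 : y0 != 0) (vPy0 : v P y0 = - b%:Z) (ry0 : regular y0).
Hypotheses (nh : h != 0) (vQh : v Q h = - b%:Z)
  (rh : forall p, p != Q -> vge (v p) 0 h).
Hypothesis pole_nongap : forall z m, regular z -> z != 0 -> v P z = - m.+1%:Z -> nongap m.+1.
Hypothesis first_nongap : forall m, (0 < m)%N -> nongap m -> (a <= m)%N.
Hypothesis first_nonmultiple : forall m, nongap m -> ~~ (a %| m)%N -> (b <= m)%N.
Hypothesis gap_interval : forall m, (n * a < m < n.+1 * a)%N -> nongap m -> m = b.

Let a_gt1 : (1 < a)%N. Proof. by lia. Qed.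
Let nsP : - a%:Z != 0. Proof. by rewrite oppr_eq0; lia. Qed.
Let nsQ : a%:Z != 0. Proof. by lia. Qed.

Lemma pole_min z : regular z -> z != 0 -> v P z < 0 -> v P z <= - a%:Z.
Proof.
move=> rz nz neg; have [m e] : exists m : nat, v P z = - m.+1%:Z.
  by exists (absz (v P z)).-1; lia.
by have := first_nongap (ltn0Sn m) (pole_nongap rz nz e); lia.
Qed.

Let vanish := regular_vanish curve_place nf ny0 vPf vPy0 rf ry0 hab a_gt1 pole_min.

(** Up to [n * a], which is less than [b], all non-gaps are multiples of [a], so the leading term of
    [z] at [P] is matched by a power of [f] and removed. *)
Lemma regular_low_pole (k : nat) z : (k <= n * a)%N -> regular z ->
  vge (v P) (- k%:Z) z -> exists q, z = ev q.
Proof.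
have pl := curve_place P.
elim/ltn_ind: k z => k IH z kn rz hz.
have [->|nz] := eqVneq z 0; first by exists 0; rewrite rmorph0.
have vz0 : v P z <= 0.
  rewrite leNgt; apply/negP => h0; move/eqP: nz; apply; apply: vanish => //.
  by rewrite /vge; apply/orP; right; lia.
have [m vz] : exists m : nat, v P z = - m%:Z by exists (absz (v P z)); lia.
have mk : (m <= k)%N by move: hz; rewrite vge_neq0 // vz; lia.
have /dvdnP[l ml] : (a %| m)%N.
  apply: contraT => nd; case: m => [|m] in vz mk nd *; first by rewrite dvdn0 in nd.
  have := first_nonmultiple (pole_nongap rz nz vz) nd.
  by move: hb hr mk kn; lia.
have nfl : f ^+ l != 0 by rewrite expf_neq0.
have vfl : v P (f ^+ l) = v P z.
  by rewrite (placeX pl) // vPf vz ml pmulrn mulrzz; lia.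
have [c nc hc] := leading_term pl nz nfl (esym vfl).
have rzc : regular (z - cst c * f ^+ l).
  apply: (regularB curve_place) => //; apply: (regularM curve_place).
    exact: (regularC curve_place).
  exact: (regularX curve_place).
have [q eq] : exists q, z - cst c * f ^+ l = ev q.
  case: m => [|m] in vz mk ml *.
    exists 0; rewrite rmorph0; apply: vanish => //.
    by apply: vge_le hc; rewrite vz.
  apply: (IH m) => //; first by lia.
  by apply: vge_le hc; rewrite vz; lia.
exists (q + c%:P * 'X^l).
by rewrite rmorphD rmorphM rmorphXn /= poly_atC poly_atX -eq subrK.
Qed.

(* The function is (h - h(P)) * f ^+ n.+1; its order a - r at Q is not a multiple of
   a, so that it is not a polynomial in f. *)
Lemma exists_adapted_function : exists2 y, y != 0 &
  [/\ regular y, v P y = - b%:Z & v Q y = (a - r)%N%:Z].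
Proof.
have plP := curve_place P; have plQ := curve_place Q.
have PQ : P != Q by rewrite eq_sym.
have [c hc] := vge_res plP (rh PQ).
have [nhc vhc] : h - cst c != 0 /\ v Q (h - cst c) = - b%:Z.
  rewrite -vQh; apply: (placeD_lt plQ) => //; rewrite (vgeN plQ).
  by apply: vge_le (vgeC plQ c); rewrite vQh; lia.
have nfn : f ^+ n.+1 != 0 by rewrite expf_neq0.
pose y := (h - cst c) * f ^+ n.+1.
have ny : y != 0 by rewrite mulf_neq0.
have vQy : v Q y = (a - r)%N%:Z.
  rewrite (placeM plQ) // (placeX plQ) // vhc vQf pmulrn mulrzz.
  by move: hb hr; nia.
have ry : regular y.
  move=> p pP; have [->|pQ] := eqVneq p Q; first by rewrite vge_neq0 // vQy.
  rewrite -[0]addr0; apply: (vgeM (curve_place p)).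
    apply: (vgeB (curve_place p)); [exact: rh|exact: (vgeC (curve_place p))].
  exact: (vge0X (curve_place p) _ (rf pP)).
(* One order better than the pole of [f ^+ n.+1], as [h - cst c] vanishes at [P]. *)
have hPy : vge (v P) (1 - (n.+1 * a)%N%:Z) y.
  apply: (vgeM plP) => //; rewrite vge_neq0 // (placeX plP) // vPf pmulrn mulrzz.
  by lia.
exists y => //; split=> //.
have not_poly q : y <> ev q.
  move=> e; have nq : q != 0 by apply: contraNneq ny => q0; rewrite e q0 rmorph0.
  have [k] := place_ev plQ nf vQf nsQ nq; rewrite -e vQy -PoszM => -[].
  by case: k => [|k]; rewrite ?muln0 ?mulnS; move: hr; clear; lia.
have vPy : v P y < - (n * a)%N%:Z.
  rewrite ltNge; apply/negP => le.
  have [//|q] := @regular_low_pole (n * a)%N y (leqnn _) ry; last exact: not_poly.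
  by rewrite vge_neq0.
have [m vm] : exists m : nat, v P y = - m.+1%:Z.
  by exists (absz (v P y)).-1; move: vPy; clear; lia.
rewrite vm; congr (- _%:Z); apply: gap_interval (pole_nongap ry ny vm).
by move: hPy vPy; rewrite vge_neq0 // vm; lia.
Qed.

Variables (g : nat) (w : 'I_g -> seq (K * K)).
Local Notation is_der D := [/\ forall x y : K, D (x + y) = D x + D y,
      forall x y : K, D (x * y) = D x * y + x * D y & forall c, D (cst c) = 0].
Local Notation diff_eval w D := (\sum_(ux <- w) ux.1 * D ux.2).
Hypothesis g_gt0 : (0 < g)%N.
Hypothesis generators : forall p, exists N (x : 'I_N -> K),
  (forall j, local_ring (has_value p) (x j)) /\
  forall z, local_ring (has_value p) z -> exists U V : {mpoly F[N]},
     (exists2 c, c != 0 & has_value p (mmap cst x V) c) /\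
     z * mmap cst x V = mmap cst x U.
Hypothesis w_regular : forall k p, exists2 w' : seq (K * K),
  forall D, is_der D -> diff_eval (w k) D = diff_eval w' D &
  forall ux, ux \in w' -> local_ring (has_value p) ux.1 /\ local_ring (has_value p) ux.2.
Hypothesis w_indep : forall c : 'I_g -> F,
  (forall D, is_der D -> \sum_k cst (c k) * diff_eval (w k) D = 0) -> forall k, c k = 0.

Lemma regular_family_bound : (2 * g <= (a - 1) * (b - (a - r)))%N.
Proof.
have ftr p : ev p = 0 -> p = 0.
  by move=> /eqP; rewrite (ev_eq0 (curve_place P) nf vPf nsP) => /eqP.
(* Without a nonzero derivation all differentials would evaluate to 0, and independence would fail
   for the coefficients constantly equal to 1, [g] being positive. *)
have [D0 [hD0 [x0 nx0]]] : exists D0, is_der D0 /\ exists x0, D0 x0 <> 0.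
  apply: contrapT => none; have /eqP : (1 : F) = 0; last by rewrite oner_eq0.
  apply: (w_indep (c := fun=> 1) _ (Ordinal g_gt0)) => D hD.
  apply: big1 => k _; rewrite big1 ?mulr0 // => ux _.
  have [->|/eqP nD] := eqVneq (D ux.2) 0; first by rewrite mulr0.
  by case: none; exists D; split=> //; exists ux.2.
have [D [hD Df Dun]] := normalized_derivation ftr hD0 nx0.
have [DD DM DC] := hD.
pose phi k := diff_eval (w k) D.
(* Used with [e = f - cst c] away from [P], where it gives the codifferent condition, and with
   [e = f] at [P], where it gives order at least [a + 1]. *)
have phi_vge p k e : e != 0 -> v p e != 0 -> D e = 1 -> vge (v p) (1 - v p e) (phi k).
  move=> ne ve De; rewrite /phi; have [w' -> // hw'] := w_regular k p.
  have pl := curve_place p; rewrite big_seq; apply: (vge_sum pl) => ux /hw'[hu hx].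
  rewrite -[1 - _]add0r; apply: (vgeM pl); first exact/local_vge.
  have [N [x [lx gen]]] := generators p.
  have [t ut] := unif p.
  have vt := ord_uniformizer (evP p) nonconstant ut.
  have nt := uniformizer_neq0 (evP p) nonconstant ut.
  apply: (der_vge DD DM DC char0 pl nt vt) => //; last exact/local_vge.
  exact: (derivation_bounded hD lx gen).
have [y ny [ry vPy vQy]] := exists_adapted_function.
have cam : coprime a (a - r).
  have rr : (r <= a)%N by move: hr; clear; lia.
  have : coprime a r by move: hab; rewrite hb /coprime gcdnMDl.
  rewrite /coprime -{1}(subnK rr) gcdnC gcdnDr gcdnC => h0.
  by rewrite gcdnC -{2}(subnKC rr) gcdnDr.
have bound : (g <= #|triangle a b (a - r)|)%N.
  apply: (codifferent_bound char0 curve_place finite_poles QP nf ny vPf vPy vQf vQy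
    rf ry hab cam a_gt1 pole_min (phi := phi)).
  - move=> k p c pP fc; have pl := curve_place p.
    have nfc : f - cst c != 0.
      rewrite subr_eq0; apply/eqP => e; have := vPf; rewrite e.
      have nc : c != 0 by apply: contraNneq nf => c0; rewrite e c0 rmorph0.
      by rewrite (placeC (curve_place P)) // => /esym/eqP; apply/negP.
    rewrite mulrC -[1](subrK (v p (f - cst c))); apply: (vgeM pl).
      apply: phi_vge => //; first by move: fc; rewrite vge_neq0 //; lia.
      by have := DD (f - cst c) (cst c); rewrite subrK DC addr0 Df.
    by rewrite /vge lexx orbT.
  - move=> k; have := phi_vge P k f nf _ Df; rewrite vPf opprK addrC; apply.
    exact: nsP.
  - move=> c hc; apply: w_indep => D' hD'; have [D'D D'M D'C] := hD'.
    transitivity (D' f * \sum_k cst (c k) * phi k); last by rewrite hc mulr0.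
    rewrite mulr_sumr; apply: eq_bigr => k _.
    rewrite mulrCA; congr (_ * _); rewrite mulr_sumr; apply: eq_bigr => ux _.
    by rewrite (Dun _ hD') mulrCA.
apply: leq_trans (card_triangle _ hab cam); first by rewrite leq_mul2l bound orbT.
rewrite hb; apply: leq_trans (leq_subr _ _) _.
exact: leq_trans (leq_pmull _ hn) (leq_addr _ _).
Qed.

End Bound.
End Curve.

(** * Local rings of a projective curve *)

Lemma cross_sub_eq0 (L : fieldType) (u v u' v' : L) : v != 0 -> v' != 0 ->
  u / v = u' / v' -> u * v' - u' * v = 0.
Proof. by move=> nv nv' /eqP; rewrite eqr_div // => /eqP ->; rewrite subrr. Qed.

Lemma div_common (L : fieldType) (u v x : L) : x != 0 -> u / v = (u / x) / (v / x).
Proof. by move=> nx; rewrite -mulf_div divff ?mulr1 // invr_eq0. Qed.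

Lemma rmorph_mmap (n : nat) (R : nzRingType) (S T : comNzRingType) (psi : {rmorphism S -> T})
    (f : R -> S) (h : 'I_n -> S) (U : {mpoly R[n]}) :
  psi (mmap f h U) = mmap (psi \o f) (psi \o h) U.
Proof.
rewrite /mmap rmorph_sum; apply: eq_bigr => m _; rewrite rmorphM; congr (_ * _).
by rewrite /mmap1 rmorph_prod; apply: eq_bigr => i _; rewrite rmorphXn.
Qed.

Lemma mmap_dehomogenize (n : nat) (R : comNzRingType) (L : fieldType)
    (phi : {rmorphism {mpoly R[n]} -> L}) (c : L) d (U : {mpoly R[n]}) :
  c != 0 -> U \is d.-homog ->
  mmap (fun a => phi a%:MP) (fun j => phi 'X_j / c) U = phi U / c ^+ d.
Proof.
move=> nc hU; rewrite [in RHS](mpolyE U) rmorph_sum mulr_suml /mmap.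
apply: eq_big_seq => m mU; rewrite -mul_mpolyC rmorphM -mulrA; congr (_ * _).
have <- : mdeg m = d by move/dhomogP: hU => /(_ m mU).
rewrite mpolyXE_id rmorph_prod mdegE /mmap1 -prodrXr -prodf_div.
by apply: eq_bigr => i _; rewrite rmorphXn expr_div_n.
Qed.

Lemma mulf_div_cancel (L : fieldType) (u v x : L) : v != 0 -> u / v * (v / x) = u / x.
Proof. by move=> nv; rewrite mulrA divfK. Qed.

Section LocalRings.
Variables (F : closedFieldType) (n : nat) (I : prime_idealr {mpoly F[n]}).
Local Notation K := (function_field I).

Lemma constant_zmod : zmod_morphism (@Defs.constant F n I).
Proof. by move=> x y; apply: val_inj; rewrite rmorphB /= mpolyCB rmorphB. Qed.

Lemma constant_monoid : monoid_morphism (@Defs.constant F n I).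
Proof.
by split=> [|x y]; apply: val_inj; rewrite /= ?rmorph1 // mpolyCM rmorphM.
Qed.

HB.instance Definition _ :=
  GRing.isZmodMorphism.Build _ _ (@Defs.constant F n I) constant_zmod.
HB.instance Definition _ :=
  GRing.isMonoidMorphism.Build _ _ (@Defs.constant F n I) constant_monoid.

Lemma ratfun_proof d (U V : {mpoly F[n]}) : U \is d.-homog -> V \is d.-homog ->
  V \notin I -> coord_proj I U / coord_proj I V \in is_ratfun (I := I).
Proof. by move=> hU hV nV; apply/asboolP; exists d, U, V. Qed.

Definition ratfun d (U V : {mpoly F[n]}) (hU : U \is d.-homog) (hV : V \is d.-homog)
  (nV : V \notin I) : K := SubFieldOf (ratfun_proof hU hV nV).

Section Value.
Variable p : point I.

Lemma point_vanish U : U \in I -> U.@[p] = 0.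
Proof. by case: p => q /= /andP[_ /asboolP h] /h. Qed.

Lemma notin_ideal U : U.@[p] != 0 -> U \notin I.
Proof. by apply: contra => /point_vanish ->. Qed.

(** A relation, because a rational function has many representations as a quotient of forms, and
    possibly none whose denominator is nonzero at [p]. *)
Definition has_value (z : K) (c : F) : Prop :=
  exists d (U V : {mpoly F[n]}),
    [/\ U \is d.-homog, V \is d.-homog, V.@[p] != 0,
        val z = coord_proj I U / coord_proj I V & c = U.@[p] / V.@[p]].

Lemma in_local_ringP z : in_local_ring p z <-> exists c, has_value z c.
Proof.
split=> [[d [U [V [hU hV nV e]]]]|[c [d [U [V [hU hV nV e _]]]]]].
  by exists (U.@[p] / V.@[p]), d, U, V.
by exists d, U, V.
Qed.

Lemma in_max_idealP z : in_max_ideal p z <-> has_value z 0.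
Proof.
split=> [[d [U [V [hU hV nV U0 e]]]]|[d [U [V [hU hV nV e c0]]]]].
  by exists d, U, V; rewrite U0 mul0r.
exists d, U, V; split=> //; apply/eqP; move/esym/eqP: c0.
by rewrite mulf_eq0 invr_eq0 (negPf nV) orbF.
Qed.

(** Equality of the two fractions puts the difference of the cross products in the ideal, so it
    vanishes at [p]. *)
Lemma has_value_uniq z c c' : has_value z c -> has_value z c' -> c = c'.
Proof.
move=> [d [U [V [hU hV nV e ->]]]] [d' [U' [V' [hU' hV' nV' e' ->]]]].
have nVI : coord_proj I V != 0 by rewrite coord_proj_eq0 notin_ideal.
have nVI' : coord_proj I V' != 0 by rewrite coord_proj_eq0 notin_ideal.
have /eqP : coord_proj I (U * V' - U' * V) = 0.
  rewrite (rmorphB (coord_proj I)) !(rmorphM (coord_proj I)).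
  by apply: cross_sub_eq0 nVI nVI' _; rewrite -e -e'.
rewrite coord_proj_eq0 => /point_vanish; rewrite rmorphB !rmorphM /= => /eqP.
by rewrite subr_eq0 -eqr_div // => /eqP.
Qed.

Lemma has_valueC c : has_value (Defs.constant I c) c.
Proof.
exists 0%N, c%:MP, 1; rewrite dhomog1 -[c%:MP]mulr1 mul_mpolyC rpredZ ?dhomog1 //.
split=> //; rewrite ?mevalZ ?rmorph1 ?oner_neq0 ?divr1 ?mulr1 //=.
by rewrite -mul_mpolyC mulr1.
Qed.

Lemma has_valueB z z' c c' : has_value z c -> has_value z' c' -> has_value (z - z') (c - c').
Proof.
move=> [d [U [V [hU hV nV e ->]]]] [d' [U' [V' [hU' hV' nV' e' ->]]]].
exists (d + d')%N, (U * V' - U' * V), (V * V'); split.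
- by apply: rpredB; [|rewrite addnC]; apply: dhomogM.
- exact: dhomogM.
- by rewrite rmorphM mulf_neq0.
- rewrite rmorphB /= e e' (rmorphB (coord_proj I)) !(rmorphM (coord_proj I));
  by apply: subf_div; rewrite coord_proj_eq0 notin_ideal.
- by rewrite rmorphB !rmorphM /= subf_div.
Qed.

Lemma has_valueM z z' c c' : has_value z c -> has_value z' c' -> has_value (z * z') (c * c').
Proof.
move=> [d [U [V [hU hV nV e ->]]]] [d' [U' [V' [hU' hV' nV' e' ->]]]].
exists (d + d')%N, (U * U'), (V * V'); split.
- exact: dhomogM.
- exact: dhomogM.
- by rewrite rmorphM mulf_neq0.
- rewrite rmorphM /= e e' !(rmorphM (coord_proj I)); exact: mulf_div.
- by rewrite !rmorphM /= mulf_div.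
Qed.

Lemma has_valueV z c : has_value z c -> c != 0 -> has_value z^-1 c^-1.
Proof.
move=> [d [U [V [hU hV nV e ->]]]] nc; exists d, V, U; split=> //.
- by apply: contraNneq nc => ->; rewrite mul0r.
- by rewrite fmorphV /= e invf_div.
- by rewrite invf_div.
Qed.

Lemma pivot : exists i : 'I_n, p i = 1.
Proof. by case: p => q /= /andP[/existsP[i /andP[/eqP h _]] _]; exists i. Qed.

(** Numerator and denominator are both divided by ['X_i ^+ d], where [p] has [i]-th coordinate 1. *)
Lemma is_local_fraction z : exists x y : K,
  [/\ in_local_ring p x, in_local_ring p y, y != 0 & z = x / y].
Proof.
have [d [U [V [hU hV nV e]]]] : exists d (U V : {mpoly F[n]}),
    [/\ U \is d.-homog, V \is d.-homog, V \notin I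
      & val z = coord_proj I U / coord_proj I V].
  by case: z => z' h; apply/asboolP.
have [i pi] := pivot.
have Xd : ('X_i ^+ d : {mpoly F[n]}) \is d.-homog.
  by rewrite -[d in d.-homog]mul1n; apply: dhomogMn; rewrite dhomogX /= mdeg1.
have nX : ('X_i ^+ d : {mpoly F[n]}).@[p] != 0.
  by rewrite rmorphXn /= mevalXU pi expr1n oner_neq0.
have nXI := notin_ideal nX.
exists (ratfun hU Xd nXI), (ratfun hV Xd nXI); split.
- by exists d, U, ('X_i ^+ d).
- by exists d, V, ('X_i ^+ d).
- apply/negP => /eqP/(congr1 val)/= /eqP.
  by rewrite mulf_eq0 invr_eq0 !coord_proj_eq0 (negPf nV) (negPf nXI).
- apply: val_inj; rewrite fmorph_div /= e; apply: div_common.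
  by rewrite coord_proj_eq0.
Qed.

Lemma is_evaluation_point : is_evaluation (@Defs.constant F n I) has_value.
Proof.
split; [exact: has_value_uniq|exact: has_valueC|exact: has_valueB|exact: has_valueM
  |exact: has_valueV|move=> z].
have [x [y [/in_local_ringP[c hc] /in_local_ringP[d hd] ny e]]] := is_local_fraction z.
by exists x, y, c, d.
Qed.

Lemma uniformizerP t : is_uniformizer p t <-> uniformizer has_value t.
Proof.
split=> -[mt ht]; split; [exact/in_max_idealP| |exact/in_max_idealP|] => z.
  by move=> /in_max_idealP/ht[u /in_local_ringP lu e]; exists u.
by move=> /in_max_idealP/ht[u lu e]; exists u => //; apply/in_local_ringP.
Qed.

Lemma has_order_atP z m : has_order p z m <-> has_order_at has_value z m.
Proof.
split=> -[t [u [/uniformizerP ut lu mu e]]]; exists t, u; split=> //.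
- exact/in_local_ringP.
- by move=> h; apply: mu; apply/in_max_idealP.
- exact/in_local_ringP.
- by move=> /in_max_idealP.
Qed.

End Value.

Lemma coordinate_function (i j : 'I_n) : exists x : K, forall p : point I,
  p i = 1 -> has_value p x (p j).
Proof.
have hX k : ('X_k : {mpoly F[n]}) \is 1.-homog by rewrite dhomogX /= mdeg1.
have [Xi|nXi] := boolP ('X_i \in I).
  exists 0 => p pi; have := point_vanish p Xi; rewrite mevalXU pi => /eqP.
  by rewrite oner_eq0.
exists (ratfun (hX j) (hX i) nXi) => p pi.
exists 1%N, 'X_j, 'X_i; split; [exact: hX|exact: hX| |by []|].
  by rewrite mevalXU pi oner_neq0.
by rewrite !mevalXU pi divr1.
Qed.

(** The generators are the affine coordinates [X_j / X_i] of a chart around [p]; a quotient of forms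
    of degree [d] is dehomogenized by dividing both by the power [d] of [X_i]. *)
Lemma local_generators (p : point I) : exists x : 'I_n -> K,
  (forall j, in_local_ring p (x j)) /\
  forall z, in_local_ring p z -> exists U V : {mpoly F[n]},
    (exists2 c, c != 0 & has_value p (mmap (@Defs.constant F n I) x V) c) /\
    z * mmap (@Defs.constant F n I) x V = mmap (@Defs.constant F n I) x U.
Proof.
have [i pi] := pivot p.
have hX k : ('X_k : {mpoly F[n]}) \is 1.-homog by rewrite dhomogX /= mdeg1.
have Xip : ('X_i : {mpoly F[n]}).@[p] != 0 by rewrite mevalXU pi oner_neq0.
have nXi := notin_ideal Xip.
have nX : coord_proj I 'X_i != 0 by rewrite coord_proj_eq0.
pose x j := ratfun (hX j) (hX i) nXi.
have ex d (U : {mpoly F[n]}) : U \is d.-homog ->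
    val (mmap (@Defs.constant F n I) x U) = coord_proj I U / coord_proj I 'X_i ^+ d.
  move=> hU; rewrite rmorph_mmap; exact: mmap_dehomogenize nX hU.
exists x; split=> [j|z [d [U [V [hU hV Vp e]]]]].
  by exists 1%N, 'X_j, 'X_i; split; [exact: hX|exact: hX|exact: Xip|by []].
have Xd : ('X_i ^+ d : {mpoly F[n]}) \is d.-homog.
  by rewrite -[d in d.-homog]mul1n; apply: dhomogMn.
have Xdp : ('X_i ^+ d : {mpoly F[n]}).@[p] = 1 by rewrite rmorphXn /= mevalXU pi expr1n.
exists U, V; split.
  exists V.@[p]; first exact: Vp.
  exists d, V, ('X_i ^+ d); split; [exact: hV|exact: Xd| | |].
  - by rewrite Xdp oner_neq0.
  - by rewrite (ex d V hV) (rmorphXn (coord_proj I)).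
  - by rewrite Xdp divr1.
have nV : coord_proj I V != 0 by rewrite coord_proj_eq0 (notin_ideal Vp).
apply: val_inj; rewrite rmorphM /= (ex d V hV) (ex d U hU) e.
by apply: mulf_div_cancel.
Qed.


(** * Consequences of dimension one *)

Hypothesis dim1 : has_dimension I 1.
Local Notation cst := (@Defs.constant F n I).

Lemma exists_nonconstant : exists x : K, forall c, x <> cst c.
Proof.
have [[x hx] _] := dim1; exists (x ord0) => c e.
pose G : {mpoly F[1]} := 'X_ord0 - c%:MP.
have G0 : G = 0.
  by apply: hx; rewrite /G rmorphB /= mmapX mmap1U mmapC e subrr.
have : G.@[fun=> c + 1] = 0 by rewrite G0 meval0.
rewrite /G mevalB mevalXU mevalC addrAC subrr add0r => /eqP.
by rewrite oner_eq0.
Qed.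

Lemma algebraic_dependence (x y : K) :
  exists2 Q : {poly {poly F}}, Q != 0 & poly_at (poly_at cst x) y Q = 0.
Proof.
have [_ /(_ 2 (fun i => if i == ord0 then x else y))] := dim1.
move=> h; have /existsNP[G /not_implyP[G0 /eqP nG]] :
    ~ alg_independent (fun i : 'I_2 => if i == ord0 then x else y).
  by move=> /h.
have m0 (m : 'X_{1..2}) : mmap1 (fun i => if i == ord0 then x else y) m =
    x ^+ m ord0 * y ^+ m ord_max.
  by rewrite /mmap1 big_ord_recl big_ord1; congr (_ * y ^+ m _); apply: val_inj.
pose Q := \sum_(m <- msupp G) (G@_m *: 'X^(m ord0))%:P * 'X^(m ord_max) : {poly {poly F}}.
exists Q; last first.
  rewrite -G0 /mmap /Q rmorph_sum; apply: eq_bigr => m _.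
  rewrite rmorphM rmorphXn /= poly_atX poly_atC m0 -mul_polyC rmorphM rmorphXn /=.
  by rewrite poly_atX poly_atC mulrA.
apply: contra_neq nG => Q0; apply/mpolyP => m; rewrite mcoeff0.
apply/eqP; apply: contraT => nm.
have : (Q`_(m ord_max))`_(m ord0) = 0 by rewrite Q0 !coef0.
rewrite /Q coef_sum coef_sum (bigD1_seq m) ?msupp_uniq ?mcoeff_msupp //= big1 => [|m' nmm].
  rewrite addr0 coefCM coefXn eqxx mulr1 coefZ coefXn eqxx mulr1 => e.
  by rewrite e eqxx in nm.
rewrite coefCM coefXn; have [e1|_] := eqVneq; last by rewrite mulr0 coef0.
rewrite mulr1 coefZ coefXn; have [e0|_] := eqVneq; last by rewrite mulr0.
case/eqP: nmm; apply/mnmP => i; case: (unliftP ord0 i) => [j|] -> //.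
by have -> : fintype.lift ord0 j = ord_max by apply: val_inj; case: j => -[].
Qed.


(** Each affine coordinate is algebraic over [z], and the relation specialized at [z = 0] leaves
    finitely many values for it at the zeros of [z]. Normalized coordinates then leave finitely many
    points. *)
Lemma finite_zeros (z : K) : z != 0 ->
  exists s : seq (point I), forall p, has_value p z 0 -> p \in s.
Proof.
move=> nz; have zc : z <> cst 0.
  by rewrite (rmorph0 cst) => z0; rewrite z0 eqxx in nz.
have hx (ij : 'I_n * 'I_n) : exists s : seq F, forall p : point I,
    p ij.1 = 1 -> has_value p z 0 -> p ij.2 \in s.
  have [x hx] := coordinate_function ij.1 ij.2.
  have [Q nQ Q0] := algebraic_dependence_at algebraic_dependence x zc.
  have [s hs] := closed_field_poly_normal (map_poly (horner_eval 0) Q).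
  exists s => p pi zp.
  have := evaluation_poly_at2 (is_evaluation_point p) Q zp (hx p pi).
  rewrite Q0 => h; have : root (map_poly (horner_eval 0) Q) (p ij.2).
    apply/rootP; apply: (has_value_uniq h).
    by rewrite -(rmorph0 cst); exact: has_valueC.
  by rewrite hs rootZ ?lead_coef_eq0 // root_prod_XsubC.
have /choice[s hs] := hx.
pose S := flatten [seq s ij | ij : 'I_n * 'I_n].
have hS p : has_value p z 0 -> forall j, p j \in S.
  move=> zp j; have [i pi] := pivot p; apply/flattenP; exists (s (i, j)).
    by apply: image_f.
  exact: (hs (i, j)).
(* All vectors with entries in [S], or 0 by default; [index] is bounded by [size S] inclusively,
   hence the successor. *)
pose T : seq {ffun 'I_n -> F} :=
  [seq [ffun j => nth 0 S (k j)] | k : {ffun 'I_n -> 'I_(size S).+1}].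
exists (pmap insub T) => p zp; rewrite mem_pmap_sub.
have idx j : (index (p j) S < (size S).+1)%N by rewrite ltnS index_size.
apply/imageP; exists [ffun j => Ordinal (idx j)] => //.
by apply/ffunP => j; rewrite !ffunE /= nth_index // hS.
Qed.

End LocalRings.

(** * From the bound to the theorem *)

Lemma genus_bound_nat (a b r g : nat) : (1 <= r <= a - 1)%N -> (a <= b)%N ->
  (g%:R : rat) > (a%:R - 1) * (b%:R - a%:R + r%:R) / 2%:R ->
  ((a - 1) * (b - (a - r)) < 2 * g)%N.
Proof.
move=> hr ab h; rewrite -(ltr_nat rat) !natrM.
have a1 : (1 <= a)%N by lia.
have ra : (r <= a)%N by lia.
have arb : (a - r <= b)%N by lia.
(* By [r <= a <= b] all truncated subtractions are exact. *)
rewrite (natrB _ a1) (natrB _ arb) (natrB _ ra).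
move: h; rewrite ltr_pdivrMr // => h.
by rewrite opprB addrCA addrC addrAC mulrC [2%:R * _]mulrC mulrC; lra.
Qed.

Theorem theoremB (R : realType) (a b n r : nat)
  (hab : coprime a b) (hb : (b = n * a + r)%N)
  (hn : (1 <= n)%N) (hr : (1 <= r <= a - 1)%N)
  (C : smooth_projective_curve R[i]) (g : nat) (hg : has_genus C g)
  (P : point C)
  (ha : is_least (fun m => (0 < m)%N /\ nongap P m) a)
  (hb' : is_least (fun m => nongap P m /\ ~~ (a %| m)%N) b)
  (hna : forall m : nat, (n * a < m < n.+1 * a)%N -> nongap P m -> m = b)
  (Q : point C) (hQP : Q <> P)
  (hQ : in_linear_system (point_mul a P) (point_mul a Q))
  (hgenus : (g%:R : rat) > (a%:R - 1) * (b%:R - a%:R + r%:R) / 2%:R) :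
  ~ nongap Q b.
Proof.
have [[nPb ndb] leb] := hb'; have [_ lea] := ha.
have b_neq0 : b <> 0%N by move=> b0; move: ndb; rewrite b0 dvdn0.
move=> [/b_neq0 []|bpfQ].
have bpfP : is_base_point_free (point_mul b P) by case: nPb => [/b_neq0 []|].
have dimC := @curve_dimension _ C.
have [_ [f nf hf]] := hQ.
(* [has_order] includes a uniformizer, so the order of [f] at a point, even when it is 0, provides
   one there. *)
have unif (p : point C) : exists t, uniformizer (has_value p) t.
  by have [t [u [ut _ _ _]]] := hf p; exists t; apply/uniformizerP.
have evP (p : point C) := is_evaluation_point p.
have ncst := exists_nonconstant dimC.
have adep := algebraic_dependence dimC.
have fz := finite_zeros dimC.
have QP : Q != P by apply/eqP.
have PQ : P != Q by rewrite eq_sym.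
have vf (p : point C) : ord (has_value p) f = a%:Z * (Q == p)%:R - a%:Z * (P == p)%:R.
  rewrite (ordE (evP p) ncst (proj1 (has_order_atP _ _ _) (hf p))).
  by rewrite coeffB !coeffU.
have vPf : ord (has_value P) f = - a%:Z.
  by rewrite vf eqxx (negPf QP) mulr0 mulr1 sub0r.
have vQf : ord (has_value Q) f = a%:Z.
  by rewrite vf eqxx (negPf PQ) mulr0 mulr1 subr0.
have rf (p : point C) : p != P -> vge (ord (has_value p)) 0 f.
  move=> pP; rewrite /vge vf [P == p]eq_sym (negPf pP) mulr0 subr0.
  by apply/orP; right; case: (Q == p); rewrite ?mulr1 ?mulr0.
(* Base point freeness at [S] itself gives a divisor avoiding [S], hence a function with a pole of
   order exactly [b] at [S] and no other pole. *)
have function_of (S : point C) : is_base_point_free (point_mul b S) -> exists u,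
    [/\ u != 0, ord (has_value S) u = - b%:Z &
      forall q, q != S -> vge (ord (has_value q)) 0 u].
  move=> /(_ S)[E [Epos [u nu hu]] ES].
  have hu' q := proj1 (has_order_atP _ _ _) (hu q).
  have [vS vq] := base_point_free_function evP ncst Epos hu' ES.
  by exists u; split; [exact: nu|exact: vS|exact: vq].
have [y0 [ny0 vy0 ry0]] := function_of P bpfP.
have [h [nh vh rh]] := function_of Q bpfQ.
have [[w [wreg windep]] _] := hg.
have ab : (a <= b)%N by rewrite hb; apply: leq_trans (leq_pmull _ hn) (leq_addr _ _).
have gb := genus_bound_nat hr ab hgenus.
have g_gt0 : (0 < g)%N by case: (posnP g) gb => // ->; rewrite muln0.
suff : (2 * g <= (a - 1) * (b - (a - r)))%N by rewrite leqNgt gb.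
have char0 k : k.+1%:R != 0 :> R[i] by rewrite pnatr_eq0.
apply: (regular_family_bound char0 evP ncst adep unif fz QP hab hb hn hr nf vPf vQf rf
  ny0 vy0 ry0 nh vh rh (nongap := nongap P) (w := w) _ _ _ hna g_gt0).
- move=> z m rz nz vz; right=> p.
  have [E [Epos [u nu hu] Ep]] := pole_base_point_free evP ncst adep unif fz rz nz vz p.
  exists E; last exact: Ep.
  split; first exact: Epos.
  by exists u; [exact: nu|move=> q; apply/has_order_atP; exact: hu].
- by move=> m m0 Nm; apply: lea.
- by move=> m Nm dm; apply: leb.
- move=> p; have [x [hx gen]] := local_generators p.
  exists _, x; split=> [j|z hz]; first exact/in_local_ringP.
  exact: (gen z (proj2 (in_local_ringP _ _) hz)).
- move=> k p; have [w' ww' hw'] := wreg k p; exists w'; first exact: ww'.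
  by move=> ux /hw'[h1 h2]; split; apply/in_local_ringP.
- exact: windep.
Qed.
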